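(* Let $X$ be an md2 graph (a finite graph in which every vertex has degree at least $2$) with edge zeta function $\zeta_X(\vec u)$. Let $W$ be a $k$-regular graph which is determined by the spectrum of its adjacency matrix. Then the numbers $s_v(W,X)$ and $s_e(W,X)$ are both determined by $\zeta_X(\vec u)$.
   Context: Graphs: A graph $X=(V,E)$ is a finite nonempty set $V$ of vertices and a finite multiset $E$ of unordered pairs of vertices, called edges. The symmetric digraph $D(X)$ has vertex set $V$ and, for each edge of $X$, two arcs (an arc $e$ and its inverse arc $\overline e$) on the same endpoints; an arc $e=(u,w)$ has origin $o(e)=u$ and terminus $t(e)=w$, and $\overline e=(w,u)$. A graph is md2 if every vertex has degree at least $2$. Prime cycles: A cycle of length $n$ in $X$ is a sequence $c=(e_1,\dots,e_n)$ of arcs of $D(X)$ with $t(e_i)=o(e_{i+1})$ for $1\le i\le n-1$ and $t(e_n)=o(e_1)$. It has backtracking if $\overline{e_{i+1}}=e_i$ for some $1\le i\le n-1$, and has a tail if $e_1=\overline{e_n}$. It is primitive if it is not obtained by going $r\ge 2$ times around some other cycle. Two cycles are equivalent if they differ by a cyclic permutation (reversing direction is not an equivalence). A prime cycle $[c]$ is an equivalence class of primitive cycles with no backtracking and no tail. Edge zeta function: Associate to each arc $e$ of $D(X)$ a variable $u_e$, and put $g(c)=\prod_{e\text{ arc in }c}u_e$ (with multiplicity). The edge zeta function of $X$ is the function of the $u_e\in\mathbb C$ (sufficiently near $0$) given by $\zeta_X(\vec u)=\prod_{[c]}(1-g(c))^{-1}$, the product over all prime cycles; it is the reciprocal of a polynomial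 in the $2|E|$ variables $u_e$. Meaning of ''determined by $\zeta_X(\vec u)$'': it is assumed that the pairing of the variable of each arc with the variable of its inverse arc is given as part of the data. Thus a quantity $Q(X)$ is determined by $\zeta_X(\vec u)$ if, whenever $X$ and $X'$ both satisfy the hypotheses on $X$ and there is a bijection $\varphi$ from the arcs of $D(X)$ to the arcs of $D(X')$ with $\varphi(\overline e)=\overline{\varphi(e)}$ under which $\zeta_X$ becomes $\zeta_{X'}$ (identifying $u_e$ with $u_{\varphi(e)}$), one has $Q(X)=Q(X')$. Induced subgraphs: For $S\subseteq V$, the vertex-induced subgraph $\langle S\rangle$ has vertex set $S$ and all edges of $X$ with both endpoints in $S$. For $R\subseteq E$, the edge-induced subgraph $\langle R\rangle$ has edge set $R$ and as vertices all vertices incident to some edge of $R$. $s_v(W,X)$ (resp. $s_e(W,X)$) is the number of vertex-induced (resp. edge-induced) subgraphs of $X$ isomorphic to $W$. $W$ is determined by the spectrum of its adjacency matrix if any graph whose adjacency matrix has the same spectrum (with multiplicities) as that of $W$ is isomorphic to $W$. *)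

(* Defs.v *)
From HB Require Import structures.
From mathcomp Require Import all_boot all_order all_algebra.
From mathcomp Require Import finmap generic_quotient.
From mathcomp Require Import boolp classical_sets reals topology normedtype.
From mathcomp Require Import summability complex.

Set Implicit Arguments.
Unset Strict Implicit.
Unset Printing Implicit Defensive.

Import Order.TTheory GRing.Theory Num.Theory.
Import numFieldNormedType.Exports.

Local Open Scope ring_scope.
Local Open Scope classical_set_scope.
Local Open Scope quotient_scope.

(* The multiset of edges is an indexed family of pairs; only the unordered pair
   [ends e] is meaningful (see [graph_iso]), and loops and parallel edges are
   allowed.  The graph without vertices inhabits this type, so that the
   subgraphs induced by empty sets make sense; [is_graph] excludes it. *)
Record multigraph := Multigraph {
  vertex : finType;
  edge : finType;
  ends : edge -> vertex * vertex }.

Definition is_graph (X : multigraph) : Prop := (0 < #|vertex X|)%N.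

Definition swap (T : Type) (p : T * T) : T * T := (p.2, p.1).

Definition graph_iso (X Y : multigraph) : Prop :=
  exists (f : vertex X -> vertex Y) (h : edge X -> edge Y),
    [/\ bijective f, bijective h &
        forall e, let p := (f (ends e).1, f (ends e).2) in
                  ends (h e) = p \/ ends (h e) = swap p].

(* The arcs of the symmetric digraph: each edge, loops included, gives the two
   arcs [(e, false)], from [(ends e).1] to [(ends e).2], and [(e, true)]. *)
Definition arc (X : multigraph) : finType := (edge X * bool)%type.

Definition inv_arc (X : multigraph) (a : arc X) : arc X := (a.1, ~~ a.2).

Definition origin (X : multigraph) (a : arc X) : vertex X :=
  if a.2 then (ends a.1).2 else (ends a.1).1.

Definition terminus (X : multigraph) (a : arc X) : vertex X :=
  origin (inv_arc a).

(* A loop contributes 2 to the degree of its vertex. *)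
Definition degree (X : multigraph) (v : vertex X) : nat :=
  #|[set a : arc X | origin a == v]|.

Definition md2 (X : multigraph) : Prop := forall v : vertex X, (2 <= degree v)%N.

Definition regular (k : nat) (X : multigraph) : Prop :=
  forall v : vertex X, degree v = k.

Definition vertex_induced (X : multigraph) (S : {set vertex X}) : multigraph :=
  @Multigraph {v : vertex X | v \in S}
    {e : edge X | ((ends e).1 \in S) && ((ends e).2 \in S)}
    (fun e => (exist _ (ends (val e)).1 (proj1 (andP (valP e))),
               exist _ (ends (val e)).2 (proj2 (andP (valP e))))).

Definition incident (X : multigraph) (R : {set edge X}) (v : vertex X) : bool :=
  [exists e in R, (v == (ends e).1) || (v == (ends e).2)].

Fact incident_ends1 (X : multigraph) (R : {set edge X}) (e : edge X) :
  e \in R -> incident R (ends e).1.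
Proof. by move=> eR; apply/exists_inP; exists e; rewrite ?eqxx. Qed.

Fact incident_ends2 (X : multigraph) (R : {set edge X}) (e : edge X) :
  e \in R -> incident R (ends e).2.
Proof. by move=> eR; apply/exists_inP; exists e; rewrite ?eqxx ?orbT. Qed.

Definition edge_induced (X : multigraph) (R : {set edge X}) : multigraph :=
  @Multigraph {v : vertex X | incident R v} {e : edge X | e \in R}
    (fun e => (exist _ (ends (val e)).1 (incident_ends1 (valP e)),
               exist _ (ends (val e)).2 (incident_ends2 (valP e)))).

Definition s_v (W X : multigraph) : nat :=
  #|[set S : {set vertex X} | `[< graph_iso (vertex_induced S) W >]]|.

Definition s_e (W X : multigraph) : nat :=
  #|[set R : {set edge X} | `[< graph_iso (edge_induced R) W >]]|.

(* Entry (u, v) counts the arcs from u to v, so a loop contributes 2 to its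
   diagonal entry and row sums are degrees. *)
Definition adjacency (R : realType) (X : multigraph) : 'M[R[i]]_#|vertex X| :=
  \matrix_(i, j) #|[set a : arc X | (origin a == enum_val i)
                                    && (terminus a == enum_val j)]|%:R.

(* Every complex number is an eigenvalue of both matrices with the same
   (algebraic) multiplicity, possibly 0. *)
Definition same_spectrum (R : realType) (m n : nat)
    (A : 'M[R[i]]_m) (B : 'M[R[i]]_n) : Prop :=
  forall z : R[i], mup z (char_poly A) = mup z (char_poly B).

Definition determined_by_spectrum (R : realType) (W : multigraph) : Prop :=
  forall Y : multigraph, is_graph Y ->
    same_spectrum (adjacency R Y) (adjacency R W) -> graph_iso Y W.

Section PrimeCycles.
Variable X : multigraph.
Implicit Type c : seq (arc X).

Definition is_cycle c : bool :=
  (c != [::]) && cycle (fun a b => terminus a == origin b) c.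

Definition backtracking c : bool :=
  ~~ sorted (fun a b => inv_arc b != a) c.

Definition has_tail c : bool :=
  if c is a :: c' then a == inv_arc (last a c') else false.

Definition primitive c : Prop :=
  forall (d : seq (arc X)) (r : nat),
    is_cycle d -> (2 <= r)%N -> c <> flatten (nseq r d).

Definition prime_representative c : bool :=
  `[< [/\ is_cycle c, primitive c, ~~ backtracking c & ~~ has_tail c] >].

Definition prime_seq := {c : seq (arc X) | prime_representative c}.

Definition rot_rel (c c' : prime_seq) : bool :=
  `[< exists k : nat, val c' = rot k (val c) >].

Fact rot_rel_refl : reflexive rot_rel.
Proof. by move=> c; apply/asboolP; exists 0%N; rewrite rot0. Qed.

Fact rot_rel_sym : symmetric rot_rel.
Proof.
suff imp (c c' : prime_seq) : rot_rel c c' -> rot_rel c' c.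
  by move=> c c'; apply/idP/idP; apply: imp.
move=> /asboolP[k e]; apply/asboolP; exists (size (val c') - k)%N.
by rewrite -/(rotr k (val c')) e rotK.
Qed.

Fact rot_rel_trans : transitive rot_rel.
Proof.
move=> c2 c1 c3 /asboolP[k e2] /asboolP[l e3]; apply/asboolP.
by exists (rot_add (val c1) k l); rewrite e3 e2 rot_rot_add.
Qed.

Canonical rot_equiv : equiv_rel prime_seq :=
  EquivRel rot_rel rot_rel_refl rot_rel_sym rot_rel_trans.

Definition prime_cycle := {eq_quot rot_equiv}.

Definition cycle_weight (K : comNzRingType) (u : arc X -> K) (P : prime_cycle) : K :=
  \prod_(e <- val (repr P)) u e.

Fact cycle_weight_pi (K : comNzRingType) (u : arc X -> K) (c : prime_seq) :
  cycle_weight u (\pi_prime_cycle c) = \prod_(e <- val c) u e.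
Proof.
rewrite /cycle_weight; case: piP => c' /eqmodP /asboolP[k ->].
by apply: perm_big; rewrite perm_rot.
Qed.

End PrimeCycles.

(* The limit of the finite subproducts along the net of finite sets of prime
   cycles (an arbitrary value where this net does not converge, which does not
   happen near 0).  The regular module [R[i]^o] carries the usual topology of
   the complex numbers. *)
Definition edge_zeta (R : realType) (X : multigraph) (u : arc X -> R[i]) : R[i] :=
  lim ((fun F : {fset prime_cycle X} =>
          \prod_(P <- F) (1 - cycle_weight u P)^-1 : R[i]^o) @ totally).

(* [phi] turns the germ at 0 of the zeta function of X into that of X'. *)
Definition zeta_match (R : realType) (X X' : multigraph)
    (phi : arc X -> arc X') : Prop :=
  exists2 r : R, 0 < r &
    forall u : arc X' -> R[i], (forall a, `|u a| < r%:C%C) ->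
      edge_zeta (u \o phi) = edge_zeta u.

Definition determined_by_zeta (R : realType) (hyp : multigraph -> Prop)
    (T : Type) (Q : multigraph -> T) : Prop :=
  forall X X' : multigraph, hyp X -> hyp X' ->
    forall phi : arc X -> arc X',
      bijective phi -> (forall a, phi (inv_arc a) = inv_arc (phi a)) ->
      zeta_match R phi -> Q X = Q X'.

(* Main.v *)
From HB Require Import structures.
From mathcomp Require Import all_boot all_order all_algebra all_field.
From mathcomp Require Import spectral generic_quotient zify ring lra.
From mathcomp Require Import boolp classical_sets reals topology normedtype.
From mathcomp Require Import summability complex.
Require Import Defs.
From mathcomp Require Import fintype finset finmap.

Set Implicit Arguments.
Unset Strict Implicit.
Unset Printing Implicit Defensive.

Import Order.TTheory GRing.Theory Num.Theory.
Import numFieldNormedType.Exports.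

(** The edge zeta function of an md2 graph determines the graph up to
    isomorphism ([iso_of_zeta]), hence also the numbers of its vertex-induced and
    edge-induced subgraphs isomorphic to a given graph.

    From the zeta function to degrees.  Let R be a set of edges.  Putting u = t on
    the arcs over R and u = 0 elsewhere turns the zeta function into the product
    of the (1 - t^n)^(-p_n), where p_n is the number of prime cycles of length n
    inside R.  Its behaviour for small t > 0 gives p_1, p_2, and so on, one after
    the other ([prime_count_of_zeta]).  A closed nonbacktracking walk is a power
    of a primitive one, so the p_n give the number of closed nonbacktracking walks
    of each length inside R ([card_closed_walks]), that is, the traces of the
    powers of the nonbacktracking matrix B of R.  The traces determine the
    eigenvalues, hence det B ([det_eq_of_traces]), and det B is, up to a sign that
    depends on the size of R only, the product over the vertices v of
    1 - deg_R v ([det_nb_inv_mx]).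

    From degrees to the graph, when vertices of degree 2 carry loops.  Write w(R)
    for that product.  It vanishes exactly when R has a vertex of degree 1, so its
    zeros on sets of at most three edges tell loops, parallel edges and triangles
    apart.  Removing one or two edges from the whole graph changes w by factors
    that reveal whether two edges have a common vertex ([adjacentE]).  Together
    this gives the number of common vertices of every nonempty set of edges
    ([concurrentE], [star_count]), and Moebius inversion gives the stars of the
    vertices, with multiplicity ([reduced_vertex_bijection]).

    The general case.  An md2 graph is a subdivision of a graph of the previous
    kind ([exists_reduction]).  A set R with w(R) <> 0 contains all or none of the
    edges of a subdivided path, and distinct paths are separated by such sets, so
    w determines which edges form a path; w then descends to the unsubdivided
    graphs.  These are isomorphic, with matching path lengths, and therefore so
    are the subdivisions ([subdivision_iso]). *)

Local Open Scope ring_scope.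

(** * Traces of powers determine the determinant *)

Lemma trig_expr (C : comNzRingType) n (T : 'M[C]_n) k : is_trig_mx T ->
  is_trig_mx (T ^+ k) /\ forall i, (T ^+ k) i i = T i i ^+ k.
Proof.
move=> /is_trig_mxP Ttrig.
elim: k => [|k [/is_trig_mxP IHt IHd]].
  split=> [|i]; last by rewrite !expr0 mxE eqxx.
  by apply/is_trig_mxP => i j ij; rewrite expr0 mxE -val_eqE /= ltn_eqF.
split=> [|i].
  apply/is_trig_mxP => i j ij; rewrite exprS mxE big1// => l _.
  have [il|li] := ltnP i l; first by rewrite Ttrig ?mul0r.
  by rewrite IHt ?mulr0// (leq_ltn_trans li ij).
rewrite exprS mxE (bigD1 i)//= IHd -exprS big1 ?addr0// => l li.
have [il|il] := ltnP i l; first by rewrite Ttrig ?mul0r.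
by rewrite IHt ?mulr0// ltn_neqAle val_eqE li.
Qed.

Lemma similar_expr (C : fieldType) n (P A : 'M[C]_n) k : P \in unitmx ->
  (P *m A *m invmx P) ^+ k = P *m A ^+ k *m invmx P.
Proof.
move=> Pu; elim: k => [|k IH]; first by rewrite !expr0 mulmx1 mulmxV.
rewrite exprS IH exprS -!mulmxE !mulmxA mulmxKV//.
Qed.

(** The sequence is the diagonal of a Schur triangular form. *)
Lemma eigenvalues_trace_det (C : numClosedFieldType) n (A : 'M[C]_n) :
  exists s : seq C, \det A = \prod_(z <- s) z /\
    forall k, \tr (A ^+ k) = \sum_(z <- s) z ^+ k.
Proof.
case: n A => [|n] A.
  by exists [::]; rewrite det_mx00 big_nil; split=> // k; rewrite big_nil /mxtrace big_ord0.
have [P Pun] := Schur A isT.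
have Pu := unitarymx_unit Pun.
rewrite /similar_to /= conjumx // => Ttrig.
set T := P *m A *m invmx P in Ttrig.
exists [seq T i i | i <- enum 'I_n.+1]; split=> [|k].
  rewrite big_map big_enum -det_trig // !det_mulmx mulrAC -det_mulmx.
  by rewrite mulmxV // det1 mul1r.
rewrite big_map big_enum; have [_ dT] := trig_expr k Ttrig.
under eq_bigr do rewrite -dT.
by rewrite -/(mxtrace _) similar_expr // mxtrace_mulC mulmxA mulVmx // mul1mx.
Qed.

(** Equal power sums give equal sums of the values of every polynomial; a
    polynomial that vanishes at all elements of both sequences except z compares
    the multiplicities of z. *)
Lemma power_sums_perm (C : numFieldType) (s s' : seq C) :
  (forall k, \sum_(z <- s) z ^+ k = \sum_(z <- s') z ^+ k) -> perm_eq s s'.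
Proof.
move=> eq_sums.
have eq_poly (p : {poly C}) : \sum_(z <- s) p.[z] = \sum_(z <- s') p.[z].
  under eq_bigr do rewrite horner_coef.
  rewrite exchange_big /=; under [RHS]eq_bigr do rewrite horner_coef.
  rewrite [RHS]exchange_big /=; apply: eq_bigr => i _.
  by rewrite -!mulr_sumr eq_sums.
apply/permP => a; rewrite -[LHS]sum1_count -[RHS]sum1_count.
have eq_mem z : count_mem z s = count_mem z s'.
  pose p := \prod_(y <- undup (s ++ s') | y != z) ('X - y%:P).
  have p0 y : y \in s ++ s' -> y != z -> p.[y] = 0.
    move=> ys yz; rewrite horner_prod (big_rem y) /= ?mem_undup //.
    by rewrite yz hornerXsubC subrr mul0r.
  have pz : p.[z] != 0.
    rewrite horner_prod prodf_seq_neq0; apply/allP => y _ /=.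
    by apply/implyP => yz; rewrite hornerXsubC subr_eq0 eq_sym.
  have sumE t : {subset t <= s ++ s'} -> \sum_(y <- t) p.[y] = p.[z] *+ count_mem z t.
    move=> ts; rewrite (bigID (pred1 z)) /= [X in _ + X]big1_seq ?addr0; last first.
      by move=> y /andP[yz /ts/p0->].
    by rewrite (eq_bigr (fun=> p.[z])) => [|y /eqP->//]; rewrite big_const_seq iter_addr_0.
  have := eq_poly p.
  rewrite !sumE => [|y yt|y yt]; rewrite ?mem_cat ?yt ?orbT //.
  by move/eqP; rewrite -subr_eq0 => /eqP /(canRL (subrK _)); rewrite add0r => /(mulrIn pz).
have /permP/(_ a) : perm_eq s s' by apply/allP => z _ /=; rewrite eq_mem.
by rewrite -!sum1_count.
Qed.

(** The exponent 0 compares the sizes of the two matrices. *)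
Lemma det_eq_of_traces (C : numClosedFieldType) m n (A : 'M[C]_m) (B : 'M[C]_n) :
  (forall k, \tr (A ^+ k) = \tr (B ^+ k)) -> \det A = \det B.
Proof.
move=> trAB.
have [s [-> sA]] := eigenvalues_trace_det A.
have [t [-> tB]] := eigenvalues_trace_det B.
by apply/perm_big/power_sums_perm => k; rewrite -sA -tB.
Qed.

(** * The determinant of the nonbacktracking matrix *)

Section Walks.
Variables (C : numFieldType) (T : finType) (r : rel T) (A : {set T}).

Definition rel_mx : 'M[C]_#|A| :=
  \matrix_(i, j) (r (enum_val i) (enum_val j))%:R.

Lemma sum_tuple_cons n (F : n.+1.-tuple T -> C) :
  \sum_c F c = \sum_a \sum_(c : n.-tuple T) F [tuple of a :: c].
Proof.
rewrite pair_big /= (reindex (fun p : T * n.-tuple T => [tuple of p.1 :: p.2])) //.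
exists (fun c => (thead c, [tuple of behead c])) => [[a c]|c] _ /=.
  by congr (_, _); apply: val_inj.
by rewrite -tuple_eta.
Qed.

Lemma rel_mx_expr n i j : (rel_mx ^+ n) i j =
  \sum_(c : n.-tuple T) (all (mem A) c && path r (enum_val i) c
                        && (last (enum_val i) c == enum_val j))%:R.
Proof.
elim: n i => [|n IH] i.
  rewrite expr0 mxE (bigD1 [tuple]) //= big1 => [|c]; last by rewrite tuple0.
  by rewrite addr0 (inj_eq enum_val_inj).
rewrite exprS mxE sum_tuple_cons.
rewrite [RHS](bigID (mem A)) /= [X in _ + X]big1 ?addr0; last first.
  by move=> a aA; rewrite big1 // => c _; rewrite (negbTE aA).
rewrite [RHS]big_enum_val /=; apply: eq_bigr => l _.
rewrite IH mxE mulr_sumr; apply: eq_bigr => c _ /=.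
by rewrite -natrM mulnb enum_valP /= !andbA [r _ _ && _]andbC.
Qed.

(** A cyclic word is counted at its last letter, where the walk starts. *)
Lemma trace_rel_mx_expr n : (0 < n)%N -> \tr (rel_mx ^+ n) =
  #|[set c : n.-tuple T | cycle r c && all (mem A) c]|%:R.
Proof.
move=> n_gt0; rewrite -sum1dep_card natr_sum /mxtrace.
under [LHS]eq_bigr do rewrite rel_mx_expr.
rewrite -(@big_enum_val _ _ _ _ (mem A) (fun a => \sum_(c : n.-tuple T)
  (all (mem A) c && path r a c && (last a c == a))%:R)) /= exchange_big /=.
rewrite [RHS]big_mkcond /=; apply: eq_bigr => -[[|x c] /=]; first by case: n n_gt0.
move=> _; rewrite rcons_path /=.
have [/andP[xA cA]|nA] := boolP ((x \in A) && _); last first.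
  by rewrite andbF big1.
have lA : last x c \in A by have := mem_last x c; rewrite inE => /predU1P[->//|/(allP cA)].
rewrite andbT (bigD1 (last x c)) //= eqxx andbT big1 ?addr0 => [|a /andP[_ /negbTE]].
  by rewrite andbC; case: (_ && _).
by rewrite eq_sym => ->; rewrite andbF.
Qed.

End Walks.

(** Sylvester's identity: both sides are the determinant of the block matrix with
    rows (1, P) and (Q, 1), reduced by eliminating either off-diagonal block. *)
Lemma det_1_subC (C : comNzRingType) m n (P : 'M[C]_(m, n)) (Q : 'M[C]_(n, m)) :
  \det (1%:M - P *m Q) = \det (1%:M - Q *m P).
Proof.
have e1 : block_mx 1%:M P Q 1%:M *m block_mx 1%:M 0 (- Q) 1%:M
        = block_mx (1%:M - P *m Q) P 0 (1%:M : 'M_n).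
  by rewrite mulmx_block !mulmx1 !mul1mx !mulmx0 !mulmxN add0r subrr add0r.
have e2 : block_mx (1%:M : 'M_m) 0 (- Q) (1%:M : 'M_n) *m block_mx 1%:M P Q 1%:M
        = block_mx 1%:M P 0 (1%:M - Q *m P).
  by rewrite mulmx_block !mulmx1 !mul1mx !mul0mx !mulNmx !addr0 addNr addrC.
have := congr1 determinant e1; rewrite det_mulmx det_lblock !det1 !mulr1 det_ublock det1 mulr1 => <-.
by have := congr1 determinant e2; rewrite det_mulmx det_lblock !det1 !mul1r det_ublock det1 mul1r => <-.
Qed.

Definition incidence (X : multigraph) (e : edge X) (v : vertex X) : nat :=
  ((ends e).1 == v) + ((ends e).2 == v).

Definition degree_in (X : multigraph) (R : {set edge X}) (v : vertex X) : nat :=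
  \sum_(e in R) incidence e v.

(** Up to sign, the determinant of the nonbacktracking matrix of R.  It is zero
    exactly when some vertex has degree 1 in R. *)
Definition degree_prod (X : multigraph) (R : {set edge X}) : int :=
  \prod_v (1 - (degree_in R v)%:Z).

Definition nb_rel (X : multigraph) : rel (arc X) :=
  fun a b => (terminus a == origin b) && (inv_arc b != a).

Definition arcs_over (X : multigraph) (R : {set edge X}) : {set arc X} :=
  [set a | a.1 \in R].

Definition closed_walks (X : multigraph) (R : {set edge X}) (n : nat) :
    {set n.-tuple (arc X)} :=
  [set c : n.-tuple (arc X) | cycle (@nb_rel X) c && all (mem (arcs_over R)) c].

Section NonBacktracking.
Variables (X : multigraph) (R : {set edge X}).
Local Notation A := (arcs_over R).
Local Notation B := (rel_mx algC (@nb_rel X) A).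

Lemma inv_arcK : involutive (@inv_arc X).
Proof. by case=> e b; rewrite /inv_arc /= negbK. Qed.

Lemma card_arcs_over : #|A| = (#|R| * 2)%N.
Proof.
rewrite -card_bool -cardsT -cardsX; apply: eq_card => -[e b].
by rewrite !inE andbT.
Qed.

Lemma sum_arcs_over (K : nmodType) (F : arc X -> K) :
  \sum_(a in A) F a = \sum_(e in R) (F (e, false) + F (e, true)).
Proof.
rewrite (eq_bigr (fun e => \sum_(b : bool) F (e, b))); last first.
  by move=> e _; rewrite big_bool addrC.
by rewrite pair_big; apply: eq_big => [[e b]|[e b]]; rewrite ?inE ?andbT.
Qed.

Definition inv_mx : 'M[algC]_#|A| := rel_mx algC (fun a b => inv_arc a == b) A.

Lemma inv_mxK : inv_mx *m inv_mx = 1%:M.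
Proof.
apply/matrixP => i j; rewrite !mxE.
have iA : inv_arc (enum_val i) \in A by have := enum_valP i; rewrite !inE.
rewrite (bigD1 (enum_rank_in iA (inv_arc (enum_val i)))) //= big1 ?addr0.
  rewrite !mxE enum_rankK_in // eqxx mul1r inv_arcK.
  by rewrite (inj_eq enum_val_inj).
move=> l; apply: contraNeq; rewrite !mxE.
case: (inv_arc (enum_val i) =P _) => [e _|_]; last by rewrite mul0r eqxx.
by apply/eqP/enum_val_inj; rewrite enum_rankK_in.
Qed.

(** These traces depend on the size of R only, hence so does the determinant of
    [inv_mx]; its value, a sign, is never computed. *)
Lemma trace_inv_mx k : \tr (inv_mx ^+ k) = (~~ odd k)%:R * (#|R| * 2)%:R.
Proof.
have -> : inv_mx ^+ k = inv_mx ^+ odd k.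
  have inv2 : inv_mx ^+ 2 = 1 by rewrite expr2 -mulmxE inv_mxK.
  by rewrite -[in LHS](odd_double_half k) exprD -muln2 mulnC exprM inv2 expr1n mulr1.
case: (odd k); rewrite ?expr1 /= ?mul0r ?mul1r.
  rewrite /mxtrace big1 // => i _; rewrite mxE; case: eqP => // /(congr1 snd) /=.
  by case: (enum_val i) => ? [].
by rewrite expr0 mxtrace1 card_arcs_over.
Qed.

Definition term_mx : 'M[algC]_(#|vertex X|, #|A|) :=
  \matrix_(i, j) (terminus (enum_val j) == enum_val i)%:R.

(** Inverting the second arc turns 'the walk goes on from a to b' into 'a and b
    have the same terminus and are distinct', which is a Gram matrix minus the
    identity. *)
Lemma mul_nb_inv_mx : B *m inv_mx = - (1%:M - term_mx^T *m term_mx).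
Proof.
apply/matrixP => i j; rewrite !mxE opprB.
have jA : inv_arc (enum_val j) \in A by have := enum_valP j; rewrite !inE.
rewrite (bigD1 (enum_rank_in jA (inv_arc (enum_val j)))) //= big1 ?addr0; last first.
  move=> l; apply: contraNeq; rewrite !mxE; case: (inv_arc _ =P _) => [e _|_].
    by apply/eqP/enum_val_inj; rewrite enum_rankK_in // -e inv_arcK.
  by rewrite mulr0 eqxx.
rewrite !mxE enum_rankK_in // inv_arcK eqxx mulr1 /nb_rel inv_arcK.
rewrite (bigD1 (enum_rank (terminus (enum_val i)))) //= big1 ?addr0; last first.
  move=> l; apply: contraNeq; rewrite !mxE; case: (terminus (enum_val i) =P _) => [->|_].
    by rewrite enum_valK.
  by rewrite mul0r eqxx.
rewrite !mxE enum_rankK eqxx mul1r (inj_eq enum_val_inj) -/(terminus _) [terminus _ == _]eq_sym.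
rewrite [j == i]eq_sym.
have [->|ij] := eqVneq i j; last by rewrite andbT subr0.
by rewrite eqxx subrr.
Qed.

(** Sylvester's identity moves the determinant from arcs to vertices, where the
    Gram matrix becomes the diagonal matrix of the degrees. *)
Lemma det_nb_inv_mx : \det B * \det inv_mx = (degree_prod R)%:~R.
Proof.
rewrite -det_mulmx mul_nb_inv_mx -scaleN1r detZ [in X in X * _]card_arcs_over.
rewrite [(-1) ^+ _]exprM sqrr_sign mul1r.
rewrite det_1_subC.
have -> : 1%:M - term_mx *m term_mx^T =
    diag_mx (\row_i (1 - (degree_in R (enum_val i))%:R)).
  apply/matrixP => i j; rewrite !mxE.
  have [->|ij] := eqVneq i j; last first.
    rewrite big1 ?subrr // => l _; rewrite !mxE; case: eqP => [->|]; last by rewrite mul0r.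
    by rewrite (inj_eq enum_val_inj) (negbTE ij) mulr0.
  rewrite mulr1n; congr (_ - _); under eq_bigr do rewrite !mxE -expr2.
  rewrite -(@big_enum_val _ _ _ _ (mem A) (fun a => (terminus a == enum_val j)%:R ^+ 2)) /=.
  rewrite sum_arcs_over /degree_in natr_sum; apply: eq_bigr => e _.
  rewrite /terminus /origin /= /incidence natrD addrC.
  by do 2!case: (_ == _); rewrite ?expr1n ?expr0n.
rewrite det_diag /degree_prod rmorph_prod.
rewrite [RHS](eq_bigl (mem (vertex X))) // [RHS]big_enum_val /=.
by apply: eq_bigr => i _; rewrite mxE rmorphB /= rmorph1 pmulrn.
Qed.

Lemma trace_nb n : (0 < n)%N -> \tr (B ^+ n) = #|closed_walks R n|%:R.
Proof. by move=> n0; rewrite trace_rel_mx_expr. Qed.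

End NonBacktracking.

Lemma degree_prod_of_closed_walks (X X' : multigraph)
    (R : {set edge X}) (R' : {set edge X'}) :
  #|R| = #|R'| ->
  (forall n, (0 < n)%N -> #|closed_walks R n| = #|closed_walks R' n|) ->
  degree_prod R = degree_prod R'.
Proof.
move=> cardR walks; apply: (@intr_inj algC); rewrite -!det_nb_inv_mx.
congr (_ * _); apply: det_eq_of_traces => k; last by rewrite !trace_inv_mx cardR.
case: k => [|k]; last by rewrite !trace_nb // walks.
by rewrite !expr0 !mxtrace1 !card_arcs_over cardR.
Qed.

Local Close Scope ring_scope.
Local Open Scope quotient_scope.

(** * Closed walks as powers of prime cycles *)

Section Words.
Variable T : eqType.
Implicit Types (c d : seq T) (r : nat).

Definition wpow r d := flatten (nseq r d).

Definition aperiodic c := forall d r, (2 <= r)%N -> c <> wpow r d.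

Lemma wpowS r d : wpow r.+1 d = d ++ wpow r d. Proof. by []. Qed.

Lemma wpowD r s d : wpow (r + s) d = wpow r d ++ wpow s d.
Proof. by elim: r => //= r IH; rewrite addSn !wpowS IH catA. Qed.

Lemma wpowM r s d : wpow (r * s) d = wpow r (wpow s d).
Proof. by elim: r => //= r IH; rewrite mulSn wpowD IH wpowS. Qed.

Lemma size_wpow r d : size (wpow r d) = (r * size d)%N.
Proof. by elim: r => //= r IH; rewrite wpowS size_cat IH mulSn. Qed.

(** Euclid's algorithm on the lengths of the two words. *)
Lemma commuting_words c d : c ++ d = d ++ c ->
  exists w i j, c = wpow i w /\ d = wpow j w.
Proof.
have [n] := ubnP (size c + size d); elim: n => // n IH in c d *.
wlog le_cd : c d / (size c <= size d)%N.
  move=> H; have [|/ltnW] := leqP (size c) (size d); first exact: H.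
  rewrite addnC => /H{}H /H{}H /esym/H[w [i [j [-> ->]]]].
  by exists w, j, i.
case: c le_cd => [_ _ _|x c le_cd lt_n eq_cd]; first by exists d, 0, 1; rewrite /wpow /= cats0.
have eq_c : take (size (x :: c)) d = x :: c.
  by rewrite -[RHS](take_size_cat d (erefl _)) eq_cd takel_cat.
rewrite -[d](cat_take_drop (size (x :: c))) eq_c in eq_cd lt_n *.
move: (drop _ _) eq_cd lt_n => z; rewrite -catA => /eqP.
rewrite eqseq_cat // eqxx /= => /eqP eq_z lt_n.
have [|w [i [j [ec ez]]]] := IH (x :: c) z _ eq_z; first by move: lt_n; rewrite size_cat /=; lia.
by exists w, i, (i + j)%N; rewrite wpowD -ec -ez.
Qed.

Lemma aperiodic_commute c d : aperiodic c -> c != [::] -> c ++ d = d ++ c ->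
  exists j, d = wpow j c.
Proof.
move=> pc c0 /commuting_words[w [i [j [ci ->]]]]; exists j.
suff -> : c = w by [].
case: i => [|[|i]] in ci; first by rewrite ci in c0.
  by rewrite ci /wpow /= cats0.
by case: (pc w i.+2).
Qed.

(** The square of the common power has both [c ++ d] and [d ++ c] as prefixes, so
    the two roots commute and are powers of one word. *)
Lemma wpow_root_uniq c d r s : aperiodic c -> aperiodic d -> c != [::] -> d != [::] ->
  (0 < r)%N -> (0 < s)%N -> wpow r c = wpow s d -> c = d.
Proof.
move=> pc pd c0 d0; case: r s => // r [] // s _ _ eq_rs.
have prefix2 (x y : seq T) i j : wpow i.+1 x = wpow j.+1 y ->
    exists z, wpow i.+1 x ++ wpow i.+1 x = x ++ y ++ z.
  move=> e; exists (wpow j y ++ wpow i x).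
  by rewrite [y ++ _]catA -wpowS -e -wpowD addSnnS addnC addSn wpowS wpowD.
have comm : c ++ d = d ++ c.
  have [z ez] := prefix2 _ _ _ _ eq_rs.
  have [z'] := prefix2 _ _ _ _ (esym eq_rs).
  rewrite -eq_rs ez !catA => /eqP; rewrite eqseq_cat ?size_cat 1?addnC // => /andP[/eqP].
  by [].
have [[|[|j]] dj] := aperiodic_commute pc c0 comm; first by rewrite dj in d0.
  by rewrite dj /wpow /= cats0.
by case: (pd c j.+2).
Qed.

Lemma wpow_root c : c != [::] ->
  exists d r, [/\ aperiodic d, d != [::], (0 < r)%N & c = wpow r d].
Proof.
have [n] := ubnP (size c); elim: n => // n IH in c *; move=> lt_n c0.
have [pc|] := pselect (aperiodic c).
  by exists c, 1; rewrite /wpow /= cats0.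
move=> /existsNP[d /existsNP[r /not_implyP[r2 /contrapT c_dr]]].
have d0 : d != [::] by apply: contraNneq c0 => d0; rewrite c_dr d0 -size_eq0 size_wpow muln0.
have [|e [s [pe e0 s0 d_es]]] := IH d _ d0.
  move: lt_n; rewrite c_dr size_wpow; have : (0 < size d)%N by rewrite lt0n size_eq0.
  by nia.
by exists e, (r * s)%N; split=> //; [rewrite muln_gt0 s0 (ltnW r2)|rewrite wpowM -d_es].
Qed.

(** If two rotations of c coincide, then some proper prefix of c commutes with the
    corresponding suffix, and c is a proper power. *)
Lemma rot_aperiodic_inj c k l : aperiodic c -> (k < size c)%N -> (l < size c)%N ->
  rot k c = rot l c -> k = l.
Proof.
move=> pc; wlog lt_kl : k l / (k < l)%N.
  by move=> H; have [/H//|lk ? ? ?|//] := ltngtP k l; apply/esym/(H l k lk).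
move=> ltk ltl eq_kl; exfalso.
pose m := (l - k)%N.
have rot_m : rot m c = c.
  by apply: (@rot_inj k); rewrite -rotD /m ?subnKC // ltnW.
have comm : take m c ++ drop m c = drop m c ++ take m c by rewrite cat_take_drop -[LHS]rot_m.
have [w [i [j [ei ej]]]] := commuting_words comm.
apply: (pc w (i + j)%N); last by rewrite wpowD -ei -ej cat_take_drop.
have m0 : (0 < m)%N by rewrite subn_gt0.
have : size (take m c) != 0 by rewrite size_takel /m; lia.
have : size (drop m c) != 0 by rewrite size_drop /m; lia.
rewrite ei ej !size_wpow; case: (i) (j) => [|i'] [|j'] //; lia.
Qed.

Lemma cycle_wpow (e : rel T) r d : (0 < r)%N -> cycle e (wpow r d) = cycle e d.
Proof.
case: r => // r _; case: d => [|x d]; first by elim: r => //= r; rewrite wpowS.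
have lastE i y : last y (wpow i (x :: d)) = if i == 0 then y else last x d.
  by case: i => // i; elim: i y => [|i IH] y; rewrite wpowS last_cat ?IH.
have pathE i y : path e y (wpow i (x :: d)) =
    ((i == 0) || e y x && path e x d) && ((i <= 1)%N || e (last x d) x).
  elim: i y => // i IH y; rewrite wpowS cat_path IH /= !ltnS.
  by case: i IH => [|i] _ /=; case: (e y x); case: (path e x d); case: (e (last x d) x);
    rewrite ?andbT ?orbT ?andbF.
rewrite wpowS /= rcons_path cat_path last_cat pathE lastE.
by rewrite rcons_path; case: r => [|r] /=; case: (path e x d); case: (e (last x d) x);
  rewrite ?andbT ?orbT ?andbF.
Qed.

Lemma rot_wpow k r d : exists d', rot k (wpow r d) = wpow r d'.
Proof.
have rot1 e : exists e', rot 1 (wpow r e) = wpow r e'.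
  case: e => [|x e]; first by exists [::]; elim: r.
  exists (rcons e x).
  have shift i : wpow i (x :: e) ++ [:: x] = x :: wpow i (rcons e x).
    by elim: i => // i IH; rewrite !wpowS -catA IH /= cat_rcons.
  case: r => // r; rewrite [wpow r.+1 (x :: e)]wpowS /= rot1_cons -cats1 -catA shift.
  by rewrite wpowS cat_rcons.
elim: k => [|k [e e_k]]; first by exists d; rewrite rot0.
have [lt|le] := ltnP k (size (wpow r d)); first by rewrite rotS // e_k.
by exists d; rewrite rot_oversize // ltnW.
Qed.

Lemma aperiodic_rot k c : aperiodic c -> aperiodic (rot k c).
Proof.
move=> pc d r r2 ec; have [d' ed] := rot_wpow (size (rot k c) - k) r d.
by apply: (pc d' r r2); rewrite -ed -ec -/(rotr k _) rotK.
Qed.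

Lemma all_wpow (a : pred T) r d : (0 < r)%N -> all a (wpow r d) = all a d.
Proof.
case: r => // r _; elim: r => [|r IH]; first by rewrite /wpow /= cats0.
by rewrite wpowS all_cat IH andbb.
Qed.

End Words.

Section PrimeCount.
Variables (X : multigraph).
Local Notation nb := (@nb_rel X).
Implicit Types (c : seq (arc X)) (R : {set edge X}).

(** Composability, absence of backtracking and absence of a tail together say that
    [nb_rel] holds between cyclically consecutive arcs. *)
Lemma prime_representativeP c :
  reflect [/\ c != [::], cycle nb c & aperiodic c] (prime_representative c).
Proof.
have nb_cycle : c != [::] -> [&& is_cycle c, ~~ backtracking c & ~~ has_tail c] = cycle nb c.
  move=> c0; rewrite /is_cycle c0 /backtracking negbK /=; case: c c0 => // a c _.
  rewrite /= !rcons_path.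
  have -> : path nb a c = path (fun a b => terminus a == origin b) a c
                       && path (fun a b => inv_arc b != a) a c.
    elim: c a => //= b c IH a; rewrite IH /nb_rel.
    by rewrite -!andbA; congr (_ && _); rewrite andbCA.
  rewrite [a == _]eq_sym /nb_rel -[_ == last a c](inj_eq (inv_inj (@inv_arcK X))) inv_arcK.
  by rewrite [a == _]eq_sym -!andbA; congr (_ && _); rewrite andbCA.
apply: (iffP (asboolP _)) => [[cc pc nb1 nb2]|[c0 cc pc]].
  have c0 : c != [::] by case/andP: cc.
  split=> //; first by rewrite -nb_cycle // cc nb1.
  move=> d r r2 ec; apply: (pc d r) => //; apply/andP; split.
    by apply: contraNneq c0 => d0; rewrite ec d0 -size_eq0 size_wpow muln0.
  by move: cc; rewrite ec /is_cycle cycle_wpow ?(ltnW r2) // => /andP[].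
move: cc; rewrite -nb_cycle // => /and3P[*]; split=> //.
by move=> d r _; apply: pc.
Qed.

Definition words n : seq (seq (arc X)) := [seq val c | c : n.-tuple (arc X)].

Lemma mem_words n c : (c \in words n) = (size c == n).
Proof.
apply/fintype.imageP/eqP => [[t _ ->]|sc]; first exact: size_tuple.
by exists (Tuple (introT eqP sc)).
Qed.

Lemma uniq_words n : uniq (words n).
Proof. by rewrite map_inj_uniq ?enum_uniq //; apply: val_inj. Qed.

Definition prime_words R n :=
  [seq c <- words n | prime_representative c && all (mem (arcs_over R)) c].

Definition cycle_over R (P : prime_cycle X) := all (mem (arcs_over R)) (val (repr P)).

Definition cycle_length (P : prime_cycle X) := size (val (repr P)).

(** There are finitely many words of a given length, so the cycles of that length
    form a finite set. *)
Definition level n : {fset prime_cycle X} :=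
  [fset P in [seq \pi_(prime_cycle X) p
             | p <- pmap (insub : _ -> option (prime_seq X)) (words n)]]%fset.

Definition prime_count R n := #|` [fset P in level n | cycle_over R P]%fset |.

Lemma mem_level n P : (P \in level n) = (cycle_length P == n).
Proof.
rewrite inE /=; apply/mapP/eqP => [[c]|<-]; last first.
  by exists (repr P); rewrite ?reprK // mem_pmap_sub mem_words.
rewrite mem_pmap_sub mem_words => /eqP <- ->; rewrite /cycle_length.
by case: piP => c' /eqmodP /asboolP[k ->]; rewrite size_rot.
Qed.

(** A prime cycle of length n has exactly n distinct representatives. *)
Lemma size_prime_words R n : size (prime_words R n) = (prime_count R n * n)%N.
Proof.
pose L := enum_fset [fset P in level n | cycle_over R P]%fset.
have memL P : (P \in L) = (cycle_length P == n) && cycle_over R P.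
  by rewrite /L -mem_level !inE.
have reprP (P : prime_cycle X) : prime_representative (val (repr P)).
  exact: (valP (repr P : prime_seq X)).
have -> : (prime_count R n * n)%N =
    size [seq rot k (val (repr P)) | P <- L, k <- iota 0 n].
  by rewrite size_allpairs size_iota.
apply/perm_size/uniq_perm; first exact/filter_uniq/uniq_words.
  apply: (@allpairs_uniq _ _ _ (fun P k => rot k (val (repr P)))); rewrite ?fset_uniq ?iota_uniq //.
  move=> [P k] [Q l] /allpairsP[[P1 k1] /= [PL kn [-> ->]]] /allpairsP[[Q1 l1] /= [QL ln [-> ->]]].
  move=> eq_rot; have eqPQ : P1 = Q1.
    rewrite -[P1]reprK -[Q1]reprK; apply/eqmodP/asboolP.
    exists (rot_add (val (repr P1)) k1 (size (rot k1 (val (repr P1))) - l1)%N).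
    by rewrite -rot_rot_add eq_rot -/(rotr l1 _) rotK.
  congr (_, _); rewrite // -eqPQ in eq_rot.
  move: PL; rewrite memL => /andP[/eqP sP _].
  move: kn ln; rewrite !mem_iota /= !add0n -sP => kn ln.
  by have [_ _ ap] := prime_representativeP _ (reprP P1); apply: rot_aperiodic_inj eq_rot.
move=> c; rewrite mem_filter mem_words; apply/andP/allpairsP => [[/andP[pc cR] /eqP sc]|].
  pose cc : prime_seq X := exist _ c pc.
  have [k ek] : exists k, c = rot k (val (repr (\pi_(prime_cycle X) cc))).
    have /eqmodP/asboolP[k /= ->] :
      \pi_(prime_cycle X) (repr (\pi_(prime_cycle X) cc)) = \pi_(prime_cycle X) cc by rewrite reprK.
    by exists k.
  set P := \pi_(prime_cycle X) cc in ek.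
  have sP : cycle_length P = n by rewrite -sc ek size_rot.
  have n0 : (0 < n)%N.
    by have [c0 _ _] := prime_representativeP _ pc; rewrite -sc lt0n size_eq0.
  exists (P, if (k < n)%N then k else 0%N); split=> /=.
  - by rewrite memL sP eqxx /cycle_over /= -(eq_all_r (mem_rot k _)) -ek.
  - by rewrite mem_iota add0n; case: ifP.
  rewrite ek; case: ltnP => // le_nk.
  by rewrite rot0 rot_oversize // -[size _]/(cycle_length P) sP.
move=> [[P k] /= [PL kn ->]]; move: PL; rewrite memL => /andP[/eqP sP gP].
split; last by rewrite size_rot -[size _]/(cycle_length P) sP.
have [P0 Pc Pa] := prime_representativeP _ (reprP P).
apply/andP; split; last by rewrite (eq_all_r (mem_rot k _)).
apply/prime_representativeP; split; last exact: aperiodic_rot.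
  by rewrite -size_eq0 size_rot size_eq0.
by rewrite rot_cycle.
Qed.

Definition closed_words R n :=
  [seq c <- words n | cycle nb c && all (mem (arcs_over R)) c].

Lemma size_closed_words R n : size (closed_words R n) = #|closed_walks R n|.
Proof.
rewrite size_filter -sum1_count big_map big_enum_cond -sum1_card.
by apply: eq_bigl => t; rewrite !inE.
Qed.

Lemma size_closed_words_sum R n : (0 < n)%N ->
  size (closed_words R n) = \sum_(d <- divisors n) size (prime_words R d).
Proof.
move=> n0.
have -> : \sum_(d <- divisors n) size (prime_words R d) =
    size [seq wpow (n %/ d) w | d <- divisors n, w <- prime_words R d].
  by rewrite size_allpairs_dep sumnE big_map.
have primeE d w : w \in prime_words R d ->
    [/\ size w = d, w != [::], cycle nb w, aperiodic w & all (mem (arcs_over R)) w].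
  rewrite mem_filter mem_words -andbA => /and3P[/prime_representativeP[? ? ?] ? /eqP ?].
  by split.
have div_gt0 d : d \in divisors n -> (0 < n %/ d)%N.
  rewrite -dvdn_divisors // => dn; have d_gt0 := dvdn_gt0 n0 dn.
  by rewrite divn_gt0 // dvdn_leq.
apply/perm_size/uniq_perm; first exact/filter_uniq/uniq_words.
  apply: allpairs_uniq_dep; first exact: divisors_uniq.
    by move=> d _; apply/filter_uniq/uniq_words.
  move=> p q /allpairsPdep[d [w [dn /primeE[sw w0 _ pw _] ->]]].
  move=> /allpairsPdep[e [v [en /primeE[sv v0 _ pv _] ->]]] /= e_wv.
  have ewv : w = v by apply: wpow_root_uniq e_wv => //; apply: div_gt0.
  by rewrite -sw -sv ewv.
move=> c; rewrite mem_filter mem_words; apply/andP/allpairsPdep => [[/andP[cc cR] /eqP sc]|].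
  have c0 : c != [::] by rewrite -size_eq0 sc -lt0n.
  have [d [r [pd d0 r0 e_c]]] := wpow_root c0.
  have d_gt0 : (0 < size d)%N by rewrite lt0n size_eq0.
  have en : n = (r * size d)%N by rewrite -sc e_c size_wpow.
  exists (size d), d; split.
  - by rewrite -dvdn_divisors // en dvdn_mull.
  - rewrite mem_filter mem_words eqxx andbT; apply/andP; split.
      by apply/prime_representativeP; split=> //; rewrite e_c cycle_wpow in cc.
    by rewrite e_c all_wpow in cR.
  by rewrite en mulnK.
move=> [d [w [dn /primeE[sw w0 cw pw wR] ->]]].
rewrite cycle_wpow ?div_gt0 // all_wpow ?div_gt0 // cw wR size_wpow sw.
by rewrite divnK // dvdn_divisors.
Qed.

(** A closed nonbacktracking walk is a power of exactly one primitive walk, whose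
    length divides its own. *)
Lemma card_closed_walks R n : (0 < n)%N ->
  #|closed_walks R n| = (\sum_(d <- divisors n) prime_count R d * d)%N.
Proof.
move=> n0; rewrite -size_closed_words size_closed_words_sum //.
by apply: eq_bigr => d _; rewrite size_prime_words.
Qed.

Lemma size_words n : size (words n) = (#|arc X| ^ n)%N.
Proof. by rewrite size_map -cardE card_tuple. Qed.

Lemma prime_count0 R : prime_count R 0 = 0%N.
Proof.
apply/eqP; rewrite cardfs_eq0; apply/eqP/fsetP => P.
have := mem_level 0 P; rewrite !inE => ->; rewrite [cycle_length _ == _]size_eq0.
have [/negbTE-> _ _] := prime_representativeP _ (valP (repr P : prime_seq X)).
by [].
Qed.

Lemma prime_count_le R n : (prime_count R n <= #|arc X| ^ n)%N.
Proof.
case: n => [|n]; first by rewrite prime_count0.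
apply: (@leq_trans (prime_count R n.+1 * n.+1)); first by rewrite leq_pmulr.
by rewrite -size_prime_words -size_words size_filter count_size.
Qed.

End PrimeCount.

Local Open Scope ring_scope.

(** * The zeta function counts the prime cycles inside an edge set *)

Section EulerProduct.
Variables (K : realType) (X : multigraph) (S : {set edge X}).
Local Notation PC := (prime_cycle X).
Local Notation N := #|arc X|.
Implicit Types (t : K) (F : {fset PC}) (P : PC).

Definition indicator_weight t (a : arc X) : K[i] :=
  if a \in arcs_over S then t%:C%C else 0.

Definition prime_weight t P : K :=
  if cycle_over S P then t ^+ cycle_length P else 0.

Definition euler_factors t F : K := \prod_(P <- F) (1 - prime_weight t P)^-1.

Lemma cycle_weight_indicator t P :
  cycle_weight (indicator_weight t) P = (prime_weight t P)%:C%C.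
Proof.
rewrite /cycle_weight /prime_weight /cycle_over /cycle_length.
elim: (val _) => [|a c IH]; first by rewrite big_nil expr0.
rewrite big_cons IH /indicator_weight /=; case: ifP => _ /=; last by rewrite mul0r.
by case: ifP => _; rewrite ?mulr0 // exprS rmorphM.
Qed.

Lemma euler_factors_complex t F :
  \prod_(P <- F) (1 - cycle_weight (indicator_weight t) P)^-1 = (euler_factors t F)%:C%C.
Proof.
rewrite /euler_factors rmorph_prod; apply: eq_bigr => P _.
by rewrite cycle_weight_indicator fmorphV rmorphB rmorph1.
Qed.

Lemma prime_weight_ge0 t P : 0 <= t -> 0 <= prime_weight t P.
Proof. by move=> t0; rewrite /prime_weight; case: ifP => // _; apply: exprn_ge0. Qed.

Definition count_in F k :=
  count (fun P => cycle_over S P && (cycle_length P == k)) F.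

Lemma count_in_le F k : (count_in F k <= prime_count S k)%N.
Proof.
rewrite /count_in -size_filter; apply: uniq_leq_size; first exact/filter_uniq/fset_uniq.
move=> P; rewrite mem_filter => /andP[/andP[gP lP] _].
by have := mem_level k P; rewrite !inE /= => ->; rewrite gP lP.
Qed.

Lemma count_in_level F k : (level X k `<=` F)%fset -> count_in F k = prime_count S k.
Proof.
move=> /fsubsetP levF; apply/eqP; rewrite eqn_leq count_in_le /count_in -size_filter.
apply: uniq_leq_size; first exact: fset_uniq.
move=> P PL; have : P \in level X k by move: PL; rewrite !inE => /andP[].
move=> Pl; rewrite mem_filter levF // -mem_level Pl.
by move: PL; rewrite !inE => /andP[_ ->].
Qed.

Lemma prod_count_in t F n :
  \prod_(P <- F | (cycle_length P < n)%N) (1 - prime_weight t P)^-1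
  = \prod_(k < n) (1 - t ^+ k)^-1 ^+ count_in F k.
Proof.
elim: n => [|n IH]; first by rewrite big_ord0 big_pred0.
rewrite (bigID (fun P => (cycle_length P < n)%N)) big_ord_recr /= -IH; congr (_ * _).
  by apply: eq_bigl => P; rewrite ltnS andb_idl // => /ltnW.
rewrite /count_in; elim: (enum_fset F) => [|P s IHs]; first by rewrite big_nil.
rewrite big_cons /= IHs ltnS -leqNgt -eqn_leq /prime_weight exprD.
have [<-|] := eqVneq (cycle_length P) n; last by rewrite andbF mul1r.
by rewrite andbT; case: ifP => _; rewrite ?expr1 // subr0 invr1.
Qed.

Lemma sum_count_in t F n m :
  \sum_(P <- F | (n <= cycle_length P < n + m)%N) prime_weight t P
  = \sum_(n <= k < n + m) t ^+ k *+ count_in F k.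
Proof.
elim: m => [|m IH].
  by rewrite addn0 big_geq // big_pred0 // => P; case: ltngtP.
rewrite (bigID (fun P => (cycle_length P < n + m)%N)) addnS big_nat_recr ?leq_addr //= -IH.
congr (_ + _).
  by apply: eq_bigl => P; rewrite ltnS; lia.
rewrite /count_in; elim: (enum_fset F) => [|P s IHs]; first by rewrite big_nil.
rewrite big_cons /= IHs /prime_weight mulrnDr.
have -> : (n <= cycle_length P < (n + m).+1)%N && ~~ (cycle_length P < n + m)%N
   = (cycle_length P == n + m)%N by lia.
have [<-|] := eqVneq (cycle_length P) (n + m)%N; last by rewrite andbF mulr0n add0r.
by rewrite andbT; case: ifP.
Qed.

Lemma geometric_le (y : K) n m : 0 <= y -> 2 * y <= 1 ->
  \sum_(n <= k < n + m) y ^+ k <= 2 * y ^+ n.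
Proof.
move=> y0 y2; suff : \sum_(n <= k < n + m) y ^+ k <= 2 * y ^+ n - 2 * y ^+ (n + m).
  by move/le_trans; apply; rewrite gerBl mulr_ge0 // exprn_ge0.
elim: m => [|m IH]; first by rewrite addn0 big_geq // subrr.
rewrite addnS big_nat_recr ?leq_addr //= exprSr; have := exprn_ge0 (n + m) y0.
by move: IH; set s := \sum_(_ <= _ < _) _; nra.
Qed.

Variable t : K.
Hypotheses (t0 : 0 <= t) (Nt : 2 * (N%:R * t) <= 1) (t1 : t < 1).

Let xge0 P : 0 <= prime_weight t P := prime_weight_ge0 P t0.

(** There are at most N^k prime cycles of length k, so those of length greater than
    n contribute a geometric series. *)
Lemma tail_le F n :
  \sum_(P <- F | (n <= cycle_length P)%N) prime_weight t P
  <= t ^+ n *+ prime_count S n + 2 * (N%:R * t) ^+ n.+1.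
Proof.
pose m := \max_(P <- F) cycle_length P.
have lt_m P : P \in F -> (cycle_length P < n + m.+1)%N.
  by move=> PF; rewrite addnS ltnS (leq_trans _ (leq_addl _ _)) // leq_bigmax_seq.
rewrite big_seq_cond (eq_bigl (fun P => (P \in F) && (n <= cycle_length P < n + m.+1)%N)); last first.
  by move=> P; case PF: (P \in F); rewrite // lt_m ?andbT.
rewrite -big_seq_cond sum_count_in addnS big_ltn ?ltnS ?leq_addr // lerD //.
  by rewrite ler_wpMn2l ?exprn_ge0 // count_in_le.
apply: le_trans (geometric_le n.+1 m _ Nt); last by rewrite mulr_ge0.
rewrite addSn; apply: ler_sum => k _; rewrite exprMn -[leLHS]mulr_natl.
by rewrite ler_wpM2r ?exprn_ge0 // -natrX ler_nat (leq_trans (count_in_le _ _)) ?prime_count_le.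
Qed.

Lemma prod_inv_ge1 (I : eqType) (s : seq I) (a : pred I) (x : I -> K) :
  (forall i, i \in s -> 0 <= x i < 1) -> 1 <= \prod_(i <- s | a i) (1 - x i)^-1.
Proof.
move=> x01; rewrite big_seq_cond.
apply: (big_ind (fun y => 1 <= y)) => // [y z y1 z1|i /andP[/x01 /andP[x0 x1] _]].
  by rewrite mulr_ege1.
by rewrite invf_ge1 ?subr_gt0 // gerBl.
Qed.

(** This is the inequality 1 - (x_1 + ... + x_m) <= (1 - x_1) ... (1 - x_m). *)
Lemma prod_inv_le (I : eqType) (s : seq I) (a : pred I) (x : I -> K) :
  (forall i, i \in s -> 0 <= x i) -> \sum_(i <- s | a i) x i < 1 ->
  \prod_(i <- s | a i) (1 - x i)^-1 <= (1 - \sum_(i <- s | a i) x i)^-1.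
Proof.
move=> x0 s1.
have [p0 ps] : 0 < \prod_(i <- s | a i) (1 - x i) /\
    1 - \sum_(i <- s | a i) x i <= \prod_(i <- s | a i) (1 - x i).
  elim: s x0 s1 => [|i s IH] x0 s1; first by rewrite !big_nil subr0.
  have xi := x0 i (mem_head _ _).
  have {}x0 j : j \in s -> 0 <= x j by move=> js; apply: x0; rewrite inE js orbT.
  move: s1; rewrite !big_cons; case: ifP => _; last exact: IH.
  have s0 : 0 <= \sum_(j <- s | a j) x j by rewrite big_seq_cond sumr_ge0 // => j /andP[/x0].
  move=> s1; have [||p0 ps] := IH => //; first lra.
  split; first by rewrite mulr_gt0 //; lra.
  nra.
rewrite prodfV lef_pV2 // posrE ?subr_gt0 //.
Qed.

Lemma cycle_length_gt0 P : (0 < cycle_length P)%N.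
Proof.
rewrite lt0n size_eq0.
by have [] := prime_representativeP _ (valP (repr P : prime_seq X)).
Qed.

Lemma prime_weight_lt1 P : prime_weight t P < 1.
Proof.
rewrite /prime_weight; case: ifP => // _.
by rewrite exprn_ilt1 // -lt0n cycle_length_gt0.
Qed.

(** The part of the Euler product coming from cycles shorter than n. *)
Definition head_factors n : K := \prod_(k < n) (1 - t ^+ k)^-1 ^+ prime_count S k.

Lemma head_factor_ge1 k : 1 <= (1 - t ^+ k)^-1 ^+ prime_count S k.
Proof.
case: k => [|k]; first by rewrite prime_count0.
rewrite exprn_ege1 // invf_ge1 ?subr_gt0 ?exprn_ilt1 //.
by rewrite gerBl exprn_ge0.
Qed.

Lemma head_factors_gt0 n : 0 < head_factors n.
Proof. by apply: prodr_gt0 => k _; rewrite (lt_le_trans ltr01) ?head_factor_ge1. Qed.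

(** Together with [euler_factors_ge] this isolates the number of prime cycles of
    length n: divided by [head_factors n], the Euler product is
    1 + prime_count S n * t^n up to O(t^(n+1)). *)
Lemma euler_factors_le F n :
  let s := t ^+ n *+ prime_count S n + 2 * (N%:R * t) ^+ n.+1 in
  s < 1 -> euler_factors t F <= head_factors n / (1 - s).
Proof.
move=> s s1; rewrite /euler_factors (bigID (fun P => (cycle_length P < n)%N)) /=.
have tail_n : \sum_(P <- F | ~~ (cycle_length P < n)%N) prime_weight t P <= s.
  by under eq_bigl do rewrite -leqNgt; apply: tail_le.
apply: ler_pM.
- by apply: prodr_ge0 => P _; rewrite invr_ge0 subr_ge0 ltW ?prime_weight_lt1.
- by apply: prodr_ge0 => P _; rewrite invr_ge0 subr_ge0 ltW ?prime_weight_lt1.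
- rewrite prod_count_in; apply: ler_prod => k _.
  case: k => -[|k] _ /=.
    have := count_in_le F 0; rewrite prime_count0 leqn0 => /eqP->.
    by rewrite expr0 ler01 lexx.
  have ge1 : 1 <= (1 - t ^+ k.+1)^-1.
    by rewrite invf_ge1 ?subr_gt0 ?exprn_ilt1 // gerBl exprn_ge0.
  by rewrite exprn_ge0 ?(le_trans ler01) //= ler_weXn2l ?count_in_le.
apply: le_trans (prod_inv_le _ _) _ => //; first exact: le_lt_trans s1.
rewrite lef_pV2 ?posrE ?subr_gt0 //; last exact: le_lt_trans s1.
by rewrite lerB.
Qed.

Lemma euler_factors_ge F n : (forall k, (k <= n)%N -> level X k `<=` F)%fset ->
  (0 < n)%N -> head_factors n * (1 + t ^+ n *+ prime_count S n) <= euler_factors t F.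
Proof.
move=> levF n0; rewrite /euler_factors (bigID (fun P => (cycle_length P < n.+1)%N)) /=.
rewrite prod_count_in big_ord_recr /=.
have -> : \prod_(k < n) (1 - t ^+ k)^-1 ^+ count_in F k = head_factors n.
  by apply: eq_bigr => k _; rewrite count_in_level // levF // ltnW.
rewrite count_in_level ?levF //.
apply: (@le_trans _ _ (head_factors n * (1 - t ^+ n)^-1 ^+ prime_count S n)).
  rewrite ler_wpM2l ?(ltW (head_factors_gt0 _)) //.
  have tn0 : 0 <= t ^+ n by rewrite exprn_ge0.
  have tn1 : t ^+ n < 1 by rewrite exprn_ilt1 // -lt0n.
  have ge : 1 + t ^+ n <= (1 - t ^+ n)^-1.
    by rewrite -[leRHS]mul1r ler_pdivlMr ?subr_gt0 //; nra.
  elim: (prime_count S n) => [|m IH]; first by rewrite mulr0n addr0 expr0.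
  rewrite mulrS exprS; move: IH; rewrite -mulr_natr; set y := t ^+ n in tn0 tn1 ge *.
  set e := (1 - y)^-1 ^+ m => IH; have m0 : 0 <= m%:R :> K by [].
  have ym : 0 <= y * m%:R by rewrite mulr_ge0.
  apply: (@le_trans _ _ ((1 + y) * e)); first nra.
  by rewrite ler_wpM2r //; lra.
rewrite ler_peMr //.
  rewrite mulr_ge0 ?(ltW (head_factors_gt0 _)) // (le_trans ler01) //.
  exact: head_factor_ge1.
by apply: prod_inv_ge1 => P _; rewrite xge0 prime_weight_lt1.
Qed.

Lemma euler_factors_mono F G : (F `<=` G)%fset -> euler_factors t F <= euler_factors t G.
Proof.
move=> FG; rewrite /euler_factors [leRHS](bigID (mem F)) /=.
have -> : \prod_(P <- G | P \in F) (1 - prime_weight t P)^-1 = euler_factors t F.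
  rewrite -big_filter; apply: perm_big; apply: uniq_perm.
  - by rewrite filter_uniq // fset_uniq.
  - exact: fset_uniq.
  by move=> P; rewrite mem_filter andb_idr // => /(fsubsetP FG).
rewrite ler_peMr //.
  by apply: prodr_ge0 => P _; rewrite invr_ge0 subr_ge0 ltW ?prime_weight_lt1.
by apply: prod_inv_ge1 => P _; rewrite xge0 prime_weight_lt1.
Qed.

End EulerProduct.

Section EdgeZeta.
Variables (K : realType) (X : multigraph) (S : {set edge X}) (t : K).
Local Notation N := #|arc X|.
Hypotheses (t0 : 0 <= t) (Nt : 2 * (N%:R * t) < 1) (t1 : t < 1).

(** The finite products increase with the finite set and are bounded, so the net
    converges to their supremum. *)
Lemma edge_zeta_indicator : exists2 z : K,
  edge_zeta (indicator_weight S t) = z%:C%C &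
  (forall F, euler_factors S t F <= z) /\
  (forall b, (forall F, euler_factors S t F <= b) -> z <= b).
Proof.
pose E := range (euler_factors S t).
have supE : has_sup E.
  split; first by exists (euler_factors S t fset0); exists fset0.
  exists (head_factors S t 0 / (1 - (t ^+ 0 *+ prime_count S 0 + 2 * (N%:R * t) ^+ 1))).
  move=> _ [F _ <-]; apply: euler_factors_le => //; first exact: ltW.
  by rewrite prime_count0 mulr0n add0r expr1.
exists (sup E).
  apply: (@cvg_lim (K[i]^o : normedModType _) _ _ _ totally_filter).
    exact: norm_hausdorff.
  apply/(@cvgrPdist_lt _ (K[i]^o : normedModType _) _ _ (@filter_filter _ _ totally_filter)) => e e0.
  have [d d0 de] : exists2 d : K, 0 < d & d%:C%C = e.
    by case: e e0 => a b; rewrite ltcE /= => /andP[/eqP-> a0]; exists a.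
  have [_ [F0 _ <-] F0d] := sup_adherent d0 supE.
  exists F0 => // F /= F0F.
  rewrite euler_factors_complex.
  have le0 := euler_factors_mono S t0 t1 F0F.
  have le1 : euler_factors S t F <= sup E.
    by apply: sup_upper_bound => //; exists F.
  rewrite -de -rmorphB /= normc_def /= expr0n addr0 sqrtr_sqr ger0_norm ?subr_ge0 // ltcR.
  by move: le0 F0d; lra.
split=> [F|b bE].
  by apply: sup_upper_bound => //; exists F.
by apply: ge_sup; [case: supE|move=> _ [F _ <-]].
Qed.

End EdgeZeta.

Section Compare.
Variables (K : realType) (X X' : multigraph) (S : {set edge X}) (S' : {set edge X'}).
Variable delta : K.
Hypothesis delta0 : 0 < delta.
Hypothesis eq_zeta : forall t, 0 < t < delta ->
  edge_zeta (indicator_weight S t) = edge_zeta (indicator_weight S' t).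

(** The two products share the factors of the cycles shorter than n.  Dividing them
    out leaves 1 + a' y <= 1 / (1 - (a y + C y t)) with y = t^n, which forces
    a' <= a when t is small. *)
Lemma prime_count_le_of_zeta n : (forall k, (k < n)%N -> prime_count S k = prime_count S' k) ->
  (prime_count S' n <= prime_count S n)%N.
Proof.
case: n => [|n] eq_counts; first by rewrite !prime_count0.
set a := prime_count S n.+1; set a' := prime_count S' n.+1.
rewrite leqNgt; apply/negP => lt_aa'.
pose N : K := #|arc X|%:R; pose N' : K := #|arc X'|%:R.
pose C := 2 * N ^+ n.+2.
(* D * t <= 1/2 makes every error term below small at once. *)
pose D := 1 + 2 * N + 2 * N' + C + a'%:R * (a%:R + C).
have N0 : 0 <= N by []. have N'0 : 0 <= N' by [].
have C0 : 0 <= C by rewrite mulr_ge0 // exprn_ge0.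
have a0 : 0 <= a%:R :> K by []. have a'0 : 0 <= a'%:R :> K by [].
have lt_a : a%:R + 1 <= a'%:R :> K by rewrite -[1]/(1%:R) -natrD ler_nat addn1.
have aC0 : 0 <= a'%:R * (a%:R + C) by rewrite mulr_ge0 // addr_ge0.
have D1 : 1 <= D by rewrite /D; lra.
have D0 : 0 < D by lra.
pose t := Num.min (delta / 2) (2 * D)^-1.
have t0 : 0 < t by rewrite lt_min divr_gt0 //= invr_gt0 mulr_gt0.
have tD : D * t <= 2^-1.
  apply: (@le_trans _ _ (D * (2 * D)^-1)); first by rewrite ler_pM2l // ge_min lexx orbT.
  by rewrite invfM mulrCA mulfV ?gt_eqF // mulr1.
have t_delta : t < delta by rewrite gt_min gtr_pMr // invf_lt1 // ltr1n.
have small c : 0 <= c -> c <= D -> c * t <= 2^-1.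
  by move=> c0 cD; apply: le_trans tD; rewrite ler_pM2r.
have half1 : 2^-1 < 1 :> K by lra.
have t1 : t < 1 by have := small 1 ler01 D1; rewrite mul1r; lra.
have Nt : 2 * (N * t) < 1.
  by rewrite mulrA (le_lt_trans (small _ _ _)) ?mulr_ge0 // /D; move: aC0; lra.
have N't : 2 * (N' * t) < 1.
  by rewrite mulrA (le_lt_trans (small _ _ _)) ?mulr_ge0 // /D; move: aC0; lra.
have [z ez [_ z_le]] := edge_zeta_indicator S (ltW t0) Nt t1.
have [z' ez' [z'_ge _]] := edge_zeta_indicator S' (ltW t0) N't t1.
have zz' : z = z'.
  by have := eq_zeta (introT andP (conj t0 t_delta)); rewrite ez ez' => -[].
pose y := t ^+ n.+1.
have y0 : 0 < y by rewrite exprn_gt0.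
have yt : y <= t by rewrite /y exprS ler_piMr ?exprn_ile1 // ltW.
pose s := y *+ a + 2 * (N * t) ^+ n.+2.
have sE : s = a%:R * y + C * (y * t).
  by rewrite /s exprMn [t ^+ _]exprSr -[y *+ a]mulr_natl mulrA.
have s0 : 0 <= s by rewrite sE addr_ge0 // mulr_ge0 // ?mulr_ge0 ?ltW.
have s_le : s <= (a%:R + C) * t.
  rewrite sE mulrDl lerD // ler_wpM2l //.
  by rewrite ler_piMl ?(ltW t0) // (le_trans yt) // ltW.
have a's : a'%:R * s + C * t <= 2^-1.
  apply: le_trans tD; apply: (@le_trans _ _ ((a'%:R * (a%:R + C) + C) * t)).
    by rewrite mulrDl lerD2r -mulrA ler_wpM2l.
  by rewrite ler_pM2r // /D; lra.
have a'1 : 1 <= a'%:R :> K by lra.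
have s1 : s < 1.
  have := mulr_ge0 C0 (ltW t0); have : s <= a'%:R * s by rewrite ler_peMl.
  by move: a's; lra.
pose h := head_factors S t n.+1.
have h0 : 0 < h by apply: head_factors_gt0 => //; apply: ltW.
have hh' : head_factors S' t n.+1 = h by apply: eq_bigr => k _; rewrite eq_counts.
have up : z <= h / (1 - s).
  by apply: z_le => F; apply: euler_factors_le => //; exact: ltW.
(* All prime cycles of length at most n + 1 in the second graph. *)
pose F := (\bigcup_(k <- iota 0 n.+2) level X' k)%fset.
have low : h * (1 + y *+ a') <= z'.
  apply: le_trans (z'_ge F); rewrite -hh'; apply: euler_factors_ge => //; first exact: ltW.
  move=> k kn; apply: (bigfcup_sup (j := k)) => //.
  by rewrite mem_iota /= add0n ltnS.
have : h * (1 + y *+ a') <= h / (1 - s) by rewrite (le_trans low) // -zz'.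
rewrite ler_pM2l // -[leRHS]mul1r ler_pdivlMr ?subr_gt0 // -mulr_natr sE.
have := mulr_ge0 (mulr_ge0 C0 (ltW t0)) (ltW y0).
have : y * (a'%:R * s + C * t) <= y * 2^-1 by rewrite ler_pM2l.
have : y * (a%:R + 1) <= y * a'%:R by rewrite ler_pM2l.
by rewrite sE; nra.
Qed.

End Compare.

Lemma prime_count_of_zeta (K : realType) (X X' : multigraph)
    (S : {set edge X}) (S' : {set edge X'}) (delta : K) : 0 < delta ->
  (forall t, 0 < t < delta ->
     edge_zeta (indicator_weight S t) = edge_zeta (indicator_weight S' t)) ->
  forall n, prime_count S n = prime_count S' n.
Proof.
move=> delta0 eq_zeta; elim/ltn_ind => n IH; apply/eqP; rewrite eqn_leq.
apply/andP; split; last exact: (prime_count_le_of_zeta delta0 eq_zeta).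
by apply: (prime_count_le_of_zeta delta0) => [t tdelta|k /IH ->]; rewrite ?eq_zeta.
Qed.

(** * Reading incidences off products of degrees *)

Section Incidence.
Variable Y : multigraph.
Implicit Types (e g h : edge Y) (u v : vertex Y) (D R : {set edge Y}).

Definition incident_to e v := (0 < incidence e v)%N.
Definition loop e := (ends e).1 == (ends e).2.
Definition parallel e g :=
  [&& ~~ loop e, ~~ loop g & [forall v, incident_to e v == incident_to g v]].

Lemma degreeE v : degree v = #|[pred a : arc Y | origin a == v]|.
Proof. by apply: eq_card => a; apply/idP/idP; rewrite classical_sets.in_setE. Qed.

Lemma degree_inT v : degree_in [set: edge Y] v = degree v.
Proof.
rewrite degreeE -sum1_card big_mkcond /=.
rewrite (eq_bigl (fun a => a \in arcs_over [set: edge Y])) => [|a]; last by rewrite !inE.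
rewrite sum_arcs_over; apply: eq_bigr => e _; rewrite !inE /origin /=.
by rewrite /incidence; do 2!case: (_ == v).
Qed.

Lemma degree_in1 e v : degree_in [set e] v = incidence e v.
Proof. by rewrite /degree_in big_set1. Qed.

Lemma degree_inU1 e R v : e \notin R -> degree_in (e |: R) v = (incidence e v + degree_in R v)%N.
Proof. by move=> eR; rewrite /degree_in big_setU1. Qed.

Lemma degree_inC R v : (degree_in R v + degree_in (~: R) v)%N = degree v.
Proof.
rewrite -degree_inT /degree_in [RHS](bigID (mem R)) /=; congr (_ + _)%N.
  by apply: eq_bigl => e; rewrite inE.
by apply: eq_bigl => e; rewrite !inE.
Qed.

Lemma degree_prod_neq0 R : (degree_prod R != 0) = [forall v, degree_in R v != 1%N].
Proof.
apply/prodf_neq0/forallP => [H v|H v _]; last by have := H v; lia.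
by have := H v isT; lia.
Qed.

Lemma incident_ends e v : incident_to e v = (v == (ends e).1) || (v == (ends e).2).
Proof. by rewrite /incident_to /incidence ![_ == v]eq_sym; case: (_ == _); case: (_ == _). Qed.

Lemma incidence_nonloop e v : ~~ loop e -> incidence e v = incident_to e v.
Proof.
rewrite /loop /incident_to /incidence.
case: (eqVneq (ends e).1 v) => [->|_]; last by case: (_ == v).
by rewrite eq_sym; case: (_ == v).
Qed.

Lemma incidence_loop e v : loop e -> incidence e v = (incident_to e v).*2.
Proof. by rewrite /loop /incident_to /incidence => /eqP->; case: (_ == _). Qed.

Lemma nonloop_ends e u v w : u != v -> incident_to e u -> incident_to e v ->
  incident_to e w = (w == u) || (w == v).
Proof.
move=> uv; rewrite !incident_ends.
have [eu|nu] := eqVneq u (ends e).1; have [ev|nv] := eqVneq v (ends e).1; rewrite /= ?orbF.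
- by rewrite eu ev eqxx in uv.
- by move=> _ /eqP->; rewrite eu.
- by move=> /eqP-> _; rewrite ev orbC.
by move=> /eqP eu /eqP ev; rewrite eu ev eqxx in uv.
Qed.

Lemma loop_incident e u v : loop e -> incident_to e u -> incident_to e v -> u = v.
Proof. by rewrite /loop !incident_ends => /eqP->; rewrite !orbb => /eqP-> /eqP->. Qed.

Lemma incident_other e u : ~~ loop e -> incident_to e u -> exists2 v, v != u & incident_to e v.
Proof.
move=> le; rewrite incident_ends => /orP[] /eqP->.
  by exists (ends e).2; rewrite ?incident_ends ?eqxx ?orbT // eq_sym.
by exists (ends e).1; rewrite ?incident_ends ?eqxx.
Qed.

Lemma incident_end1 e : incident_to e (ends e).1.
Proof. by rewrite incident_ends eqxx. Qed.

Lemma parallel_common e g u v : u != v -> incident_to e u -> incident_to e v ->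
  incident_to g u -> incident_to g v -> parallel e g.
Proof.
move=> uv eu ev gu gv; apply/and3P; split.
- by apply/negP => /loop_incident /(_ eu) /(_ ev) /eqP; apply/negP.
- by apply/negP => /loop_incident /(_ gu) /(_ gv) /eqP; apply/negP.
by apply/forallP => w; rewrite (nonloop_ends w uv eu ev) (nonloop_ends w uv gu gv).
Qed.

Lemma loopE e : loop e = (degree_prod [set e] != 0).
Proof.
rewrite degree_prod_neq0; apply/idP/forallP => [le v|H].
  by rewrite degree_in1 incidence_loop //; case: (incident_to _ _).
apply/negPn/negP => le; have := H (ends e).1.
by rewrite degree_in1 incidence_nonloop // incident_end1.
Qed.

Lemma parallelE e g : e != g -> parallel e g =
  [&& ~~ loop e, ~~ loop g & degree_prod [set e; g] != 0].
Proof.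
move=> eg; rewrite /parallel; case: (boolP (loop e)) => //= le.
case: (boolP (loop g)) => //= lg; rewrite degree_prod_neq0; apply: eq_forallb => v.
rewrite degree_inU1 ?inE // degree_in1 !incidence_nonloop //.
by case: (incident_to e v); case: (incident_to g v).
Qed.

Definition adjacent e g := [exists v, incident_to e v && incident_to g v].

(** For an md2 graph: a vertex of degree 2 only carries a loop, so no vertex
    subdivides an edge. *)
Definition reduced := forall e v, ~~ loop e -> incident_to e v -> (3 <= degree v)%N.

(** Let c = deg v - 1, and let p and q be the incidences of e and g at v.  The
    factors of the two products at v are (c - p - q) c and (c - p)(c - q), which
    differ by p q.  Edges that are not parallel share at most one vertex, and no
    other factor vanishes, because vertices on edges that are not loops have
    degree at least 3. *)
Lemma adjacentE e g : md2 Y -> reduced -> e != g -> ~~ parallel e g ->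
  adjacent e g = (degree_prod (~: [set e; g]) * degree_prod [set: edge Y]
                  != degree_prod (~: [set e]) * degree_prod (~: [set g])).
Proof.
move=> md red eg npar; rewrite /degree_prod -!big_split /=.
have d1 v : degree_in (~: [set e]) v = (degree v - incidence e v)%N.
  by rewrite -(degree_inC [set e]) degree_in1 addKn.
have d2 v : degree_in (~: [set g]) v = (degree v - incidence g v)%N.
  by rewrite -(degree_inC [set g]) degree_in1 addKn.
have d3 v : degree_in (~: [set e; g]) v = (degree v - (incidence e v + incidence g v))%N.
  by rewrite -(degree_inC [set e; g]) degree_inU1 ?inE // degree_in1 addKn.
have le_d v : (incidence e v + incidence g v <= degree v)%N.
  by rewrite -(degree_inC [set e; g]) degree_inU1 ?inE // degree_in1 leq_addr.
have same v : ~~ (incident_to e v && incident_to g v) ->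
  (1 - (degree_in (~: [set e; g]) v)%:Z) * (1 - (degree_in [set: edge Y] v)%:Z) =
  (1 - (degree_in (~: [set e]) v)%:Z) * (1 - (degree_in (~: [set g]) v)%:Z).
  rewrite d1 d2 d3 degree_inT /incident_to negb_and -!leqNgt !leqn0 => /orP[]/eqP->.
    by rewrite add0n subn0 mulrC.
  by rewrite addn0 subn0.
apply/existsP/idP => [[v /andP[ev gv]]|]; last first.
  move=> neq; apply/existsP; apply: contraNT neq => /existsPn H.
  by apply/eqP; apply: eq_bigr => v _; exact: same.
have uniq_v u : u != v -> ~~ (incident_to e u && incident_to g u).
  by move=> uv; apply: contra npar => /andP[eu gu]; apply: parallel_common uv _ _ _ _.
rewrite (bigD1 v) //= [X in _ != X](bigD1 v) //=.
rewrite (eq_bigr _ (fun u uv => same u (uniq_v u uv))).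
have rest : \prod_(u | u != v) ((1 - (degree_in (~: [set e]) u)%:Z) *
    (1 - (degree_in (~: [set g]) u)%:Z)) != 0.
  apply/prodf_neq0 => u uv.
  have := uniq_v u uv; rewrite negb_and.
  have factor a : incident_to a v -> ((degree u - incidence a u) != 1)%N.
    move=> av; have [la|la] := boolP (loop a).
      rewrite incidence_loop //; case: (boolP (incident_to a u)) => au.
        by rewrite (loop_incident la au av) eqxx in uv.
      by rewrite subn0; have := md u; lia.
    rewrite incidence_nonloop //; case: (boolP (incident_to a u)) => au; last first.
      by rewrite subn0; have := md u; lia.
    by have := red a u la au; lia.
  move=> _; rewrite mulf_eq0 negb_or d1 d2.
  by have := factor e ev; have := factor g gv; lia.
rewrite (inj_eq (mulIf rest)).
rewrite d1 d2 d3 degree_inT; have := le_d v; move: ev gv; rewrite /incident_to.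
by move: (incidence e v) (incidence g v) (degree v) => a b d a0 b0 ab; nia.
Qed.

Lemma parallel_incident e g v : parallel e g -> incident_to e v = incident_to g v.
Proof. by case/and3P=> _ _ /forallP/(_ v)/eqP. Qed.

Definition concurrent D := [exists v, [forall e in D, incident_to e v]].

(** Triples for which pairwise adjacency has two possible causes: three edges at a
    common vertex, or a triangle. *)
Definition skew e g h :=
  [&& ~~ loop e, ~~ loop g, ~~ loop h, ~~ parallel e g, ~~ parallel e h & ~~ parallel g h].

Lemma skew_tripleE e g h : skew e g h ->
  forall v, degree_in [set e; g; h] v = (incident_to e v + incident_to g v + incident_to h v)%N.
Proof.
move=> /and5P[le lg lh peg /andP[peh pgh]] v.
have neq a b : ~~ loop a -> ~~ parallel a b -> a != b.
  move=> la; apply: contraNneq => <-; apply/and3P; split=> //.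
  by apply/forallP.
rewrite -setUA degree_inU1 ?degree_inU1 ?degree_in1 ?incidence_nonloop ?addnA // !inE ?neq //.
by rewrite negb_or !neq.
Qed.

(** A Helly property: pairwise adjacent edges have a common vertex unless three of
    them form a triangle, and a triangle is the only skew triple of pairwise
    adjacent edges without a vertex of degree 1. *)
Lemma concurrentE D e0 : e0 \in D -> concurrent D =
  [forall e in D, forall g in D, adjacent e g] &&
  [forall e in D, forall g in D, forall h in D,
     skew e g h ==> (degree_prod [set e; g; h] == 0)].
Proof.
move=> e0D; apply/existsP/andP => [[v /forall_inP vD]|[/forall_inP adjD /forall_inP triD]].
  split; apply/forall_inP => e eD; apply/forall_inP => g gD.
    by apply/existsP; exists v; rewrite !vD.
  apply/forall_inP => h hD; apply/implyP => sk.
  have /and5P[le lg lh peg /andP[peh pgh]] := sk.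
  rewrite -[_ == 0]negbK degree_prod_neq0; apply/forallPn.
  have [u uv eu] := incident_other le (vD e eD).
  have not_u a : ~~ parallel e a -> a \in D -> ~~ incident_to a u.
    move=> pea aD; apply: contra pea => au.
    by apply: parallel_common uv eu _ au _; apply: vD.
  exists u; rewrite negbK skew_tripleE // eu.
  by rewrite (negbTE (not_u g peg gD)) (negbTE (not_u h peh hD)).
have adj e g : e \in D -> g \in D -> exists2 v, incident_to e v & incident_to g v.
  by move=> eD gD; have /forall_inP/(_ g gD)/existsP[v /andP[]] := adjD e eD; exists v.
have [/exists_inP[l lD ll]|/exists_inPn noloop] := boolP [exists l in D, loop l].
  exists (ends l).1; apply/forall_inP => e eD.
  have [v ev lv] := adj e l eD lD.
  by rewrite -(loop_incident ll lv (incident_end1 l)).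
have [/forall_inP allpar|] := boolP [forall e in D, parallel e0 e].
  exists (ends e0).1; apply/forall_inP => e eD.
  by rewrite -(parallel_incident _ (allpar e eD)) incident_end1.
move=> /forall_inPn[g gD peg].
have [v ev gv] := adj e0 g e0D gD.
exists v; apply/forall_inP => h hD; apply/negPn/negP => hv.
have peh : ~~ parallel e0 h by apply: contra hv => p; rewrite -(parallel_incident v p).
have pgh : ~~ parallel g h by apply: contra hv => p; rewrite -(parallel_incident v p).
have sk : skew e0 g h by rewrite /skew !noloop // peg peh.
have /forall_inP/(_ g gD)/forall_inP/(_ h hD) := triD e0 e0D.
rewrite sk /= => /eqP/eqP; rewrite -[_ == 0]negbK degree_prod_neq0 => /forallPn[u].
rewrite negbK skew_tripleE //.
have [x ex hx] := adj e0 h e0D hD; have [y gy hy] := adj g h gD hD.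
have vx : v != x by apply: contraNneq hv => ->.
have vy : v != y by apply: contraNneq hv => ->.
have xy : x != y.
  by apply: contraNneq peg => exy; apply: parallel_common vx ev ex gv _; rewrite exy.
rewrite (nonloop_ends u vx ev ex) (nonloop_ends u vy gv gy) (nonloop_ends u xy hx hy).
have [->|uv] := eqVneq u v; first by rewrite (negbTE vx) (negbTE vy).
by have [->|ux] := eqVneq u x; rewrite /= ?(negbTE xy) //; case: (u == y).
Qed.

Definition star v : {set edge Y} := [set e | incident_to e v].

(** Two distinct common vertices of a set of edges are the ends of each of its
    edges. *)
Lemma star_count D e0 : e0 \in D ->
  #|[set v | D \subset star v]| =
  if concurrent D then (if [forall e in D, parallel e0 e] then 2 else 1)%N else 0%N.
Proof.
move=> e0D; have memS v : (v \in [set v | D \subset star v]) = [forall e in D, incident_to e v].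
  rewrite inE; apply/subsetP/forall_inP => H e /H; by rewrite inE.
case: ifP => [/existsP[v vD]|/negbT/existsPn none]; last first.
  by apply: eq_card0 => v; rewrite memS; apply/negbTE/none.
have inc e : e \in D -> incident_to e v by move: vD => /forall_inP; apply.
case: ifP => [/forall_inP allpar|/negbT/forall_inPn[g gD npar]].
  have le : ~~ loop e0 by case/and3P: (allpar e0 e0D).
  have [u uv eu] := incident_other le (inc e0 e0D).
  apply: (@etrans _ _ #|[set u; v]|); last by rewrite cards2 uv.
  apply: eq_card => w; rewrite memS !inE -(nonloop_ends w uv eu (inc e0 e0D)).
  apply/forall_inP/idP => [/(_ e0 e0D)//|ew e eD].
  by rewrite -(parallel_incident w (allpar e eD)).
apply/eqP/cards1P; exists v; apply/setP => u; rewrite memS !inE.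
apply/forall_inP/eqP => [uD|-> //]; apply/eqP; apply: contraNT npar => uv.
by apply: parallel_common uv _ _ _ _; rewrite ?inc ?uD.
Qed.

End Incidence.

(** Moebius inversion on the lattice of subsets, by descending induction. *)
Lemma card_fiber_of_card_above (V V' E : finType) (s : V -> {set E}) (s' : V' -> {set E}) :
  (forall D, D != set0 -> #|[set v | D \subset s v]| = #|[set v | D \subset s' v]|) ->
  forall D, D != set0 -> #|[set v | s v == D]| = #|[set v | s' v == D]|.
Proof.
move=> above D.
have sumE (U : finType) (t : U -> {set E}) (D0 : {set E}) : #|[set v | D0 \subset t v]| =
    (#|[set v | t v == D0]| + \sum_(D' : {set E} | D0 \proper D') #|[set v | t v == D']|)%N.
  rewrite -sum1dep_card (partition_big t (fun D' : {set E} => D0 \subset D')) //=.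
  rewrite (bigD1 D0) ?subxx //=; congr (_ + _)%N.
    rewrite -sum1dep_card; apply: eq_bigl => v.
    by case: eqP => [->|]; rewrite ?subxx ?andbF.
  apply: eq_big => [D'|D' /andP[D0D' _]]; first by rewrite properEneq andbC eq_sym.
  rewrite -sum1dep_card; apply: eq_bigl => v.
  by case: eqP => [->|]; rewrite ?D0D' ?andbF.
have [n] := ubnP (#|E| - #|D|)%N; elim: n => // n IH in D *; move=> ltn D0.
have := above D D0; rewrite !sumE.
rewrite (eq_bigr (fun D' => #|[set v | s' v == D']|)) => [/addIn//|D' DD'].
apply: IH; last by apply: contraTneq DD' => ->; rewrite properE sub0set andbF.
have ltDD' := proper_card DD'; have leE : (#|D'| <= #|E|)%N := max_card _.
by rewrite -ltnS (leq_trans _ ltn) // ltnS ltn_sub2l // (leq_trans ltDD').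
Qed.

(** A point is sent to the point of equal rank in the fiber over the same value. *)
Lemma bijection_of_card_fiber (V V' : finType) (K : eqType) (a : V -> K) (b : V' -> K) :
  (forall k, #|[set v | a v == k]| = #|[set v | b v == k]|) ->
  exists2 f : V -> V', bijective f & forall v, b (f v) = a v.
Proof.
have inj_map (U U' : finType) (c : U -> K) (d : U' -> K) :
    (forall k, #|[set v | c v == k]| = #|[set v | d v == k]|) ->
    exists2 f : U -> U', injective f & forall v, d (f v) = c v.
  move=> cd; pose i v := index v (enum [set w | c w == c v]).
  have i_lt v : (i v < #|[set w | d w == c v]|)%N.
    by rewrite -cd cardE index_mem mem_enum inE eqxx.
  have x0 (v : U) : U'.
    case: (pickP (fun w => d w == c v)) => [w _|none]; first exact: w.
    by have := i_lt v; rewrite eq_card0 // => w; rewrite inE none.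
  exists (fun v => nth (x0 v) (enum [set w | d w == c v]) (i v)) => [v w|v].
    move=> e.
    have dE u : d (nth (x0 u) (enum [set w | d w == c u]) (i u)) = c u.
      have : nth (x0 u) (enum [set w | d w == c u]) (i u) \in [set w | d w == c u].
        by rewrite -mem_enum mem_nth // -cardE.
      by rewrite inE => /eqP.
    have cvw : c v = c w by rewrite -[LHS]dE e dE.
    have iw : i v = i w.
      move: e; rewrite (set_nth_default (x0 w)) -?cardE // cvw => /eqP.
      by rewrite nth_uniq ?enum_uniq -?cardE ?i_lt -1?cvw // => /eqP.
    have mv u : u \in enum [set x | c x == c u] by rewrite mem_enum inE.
    by rewrite -(nth_index v (mv v)) -/(i v) iw /i cvw nth_index // mv.
  have : nth (x0 v) (enum [set w | d w == c v]) (i v) \in [set w | d w == c v].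
    by rewrite -mem_enum mem_nth // -cardE.
  by rewrite inE => /eqP.
move=> ab; have [f finj fE] := inj_map _ _ a b ab.
have [g ginj _] := inj_map _ _ b a (fun k => esym (ab k)).
by exists f => //; apply: inj_card_bij finj (leq_card g ginj).
Qed.

Lemma imset_setC (E E' : finType) (phi : E -> E') (A : {set E}) :
  bijective phi -> phi @: (~: A) = ~: (phi @: A).
Proof.
move=> [psi phiK psiK]; apply/setP => e; rewrite !inE -[e]psiK !(mem_imset _ _ (can_inj phiK)).
by rewrite inE.
Qed.

(** * Reconstruction of graphs without subdivided edges *)

Section ReducedIso.
Variables (Y Y' : multigraph) (phi : edge Y -> edge Y').
Hypotheses (phi_bij : bijective phi).
Hypotheses (mdY : md2 Y) (mdY' : md2 Y') (redY : reduced Y) (redY' : reduced Y').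
Hypothesis phi_prod : forall R : {set edge Y}, degree_prod (phi @: R) = degree_prod R.

Let phi_inj := bij_inj phi_bij.

Lemma phi_loop e : loop (phi e) = loop e.
Proof. by rewrite !loopE -imset_set1 phi_prod. Qed.

Lemma phi_parallel e g : parallel (phi e) (phi g) = parallel e g.
Proof.
have [->|eg] := eqVneq e g.
  have par1 Z (h : edge Z) : parallel h h = ~~ loop h.
    by rewrite /parallel; case: (loop h) => //=; apply/forallP.
  by rewrite !par1 phi_loop.
rewrite !parallelE ?(inj_eq phi_inj) // !phi_loop.
by rewrite -!imset_set1 -imsetU phi_prod.
Qed.

Lemma phi_adjacent e g : adjacent (phi e) (phi g) = adjacent e g.
Proof.
have adj1 Z (h : edge Z) : adjacent h h.
  by apply/existsP; exists (ends h).1; rewrite incident_end1.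
have [->|eg] := eqVneq e g; first by rewrite !adj1.
have [par|npar] := boolP (parallel e g).
  have adj_par Z (h k : edge Z) : parallel h k -> adjacent h k.
    move=> hk; apply/existsP; exists (ends h).1.
    by rewrite -(parallel_incident _ hk) incident_end1.
  by rewrite !adj_par ?phi_parallel.
rewrite !adjacentE ?(inj_eq phi_inj) ?phi_parallel //.
rewrite -!imset_set1 -!imsetU -!imset_setC //.
have -> : [set: edge Y'] = phi @: [set: edge Y].
  by apply/esym/setP => e'; have [psi _ psiK] := phi_bij; rewrite inE -[e']psiK imset_f.
by rewrite !phi_prod.
Qed.

Lemma phi_concurrent (D : {set edge Y}) e0 : e0 \in D -> concurrent (phi @: D) = concurrent D.
Proof.
move=> e0D; rewrite (concurrentE (imset_f phi e0D)) (concurrentE e0D).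
have forall_phi (P : pred (edge Y')) :
    [forall e in phi @: D, P e] = [forall e in D, P (phi e)].
  apply/forall_inP/forall_inP => H e eD; first exact/H/imset_f.
  by case/imsetP: eD => d dD ->; apply: H.
congr (_ && _); rewrite !forall_phi; apply: eq_forallb_in => e _.
  by rewrite forall_phi; apply: eq_forallb_in => g _; rewrite phi_adjacent.
rewrite forall_phi; apply: eq_forallb_in => g _.
rewrite forall_phi; apply: eq_forallb_in => h _.
by rewrite /skew !phi_loop !phi_parallel -!imset_set1 -!imsetU phi_prod.
Qed.

Theorem reduced_vertex_bijection : exists2 f : vertex Y -> vertex Y', bijective f &
  forall e v, incident_to (phi e) (f v) = incident_to e v.
Proof.
pose s' v := phi @^-1: star v.
have above D : D != set0 -> #|[set v | D \subset star v]| = #|[set v | D \subset s' v]|.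
  case/set0Pn => e0 e0D.
  have -> : [set v | D \subset s' v] = [set v | phi @: D \subset star v].
    by apply/setP => v; rewrite !inE sub_imset_pre.
  rewrite (star_count e0D) (star_count (imset_f phi e0D)) (phi_concurrent e0D).
  suff -> : [forall e in phi @: D, parallel (phi e0) e] = [forall e in D, parallel e0 e] by [].
  apply/forall_inP/forall_inP => H e.
    by move=> eD; rewrite -phi_parallel H // imset_f.
  by case/imsetP => d dD ->; rewrite phi_parallel H.
have star_neq0 Z (v : vertex Z) : md2 Z -> star v != set0.
  move=> /(_ v); apply: contraTneq => star0; rewrite -leqNgt -degree_inT /degree_in.
  rewrite big1 // => e _; apply/eqP; rewrite -leqn0 leqNgt; apply/negP => ev.
  by have := in_set0 e; rewrite -star0 inE => /negP.
have [|f fbij fE] := @bijection_of_card_fiber _ _ _ (@star Y) s'.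
  move=> D; have [->|D0] := eqVneq D set0; last exact: card_fiber_of_card_above.
  rewrite !eq_card0 // => v; rewrite inE; apply/negbTE.
    rewrite /s'; have /set0Pn[e' ve'] := star_neq0 _ v mdY'.
    have [psi _ psiK] := phi_bij.
    by apply/set0Pn; exists (psi e'); rewrite inE psiK.
  exact: star_neq0.
exists f => // e v; have := congr1 (fun A : {set edge Y} => e \in A) (fE v).
by rewrite !inE.
Qed.

End ReducedIso.

Lemma ends_of_incident (Y Y' : multigraph) (f : vertex Y -> vertex Y') (e : edge Y) (e' : edge Y') :
  bijective f -> (forall v, incident_to e' (f v) = incident_to e v) ->
  let p := (f (ends e).1, f (ends e).2) in ends e' = p \/ ends e' = swap p.
Proof.
move=> fbij; have finj := bij_inj fbij; rewrite /swap /= => inc.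
have := inc (ends e).1; have := inc (ends e).2; have [g fK gK] := fbij.
have := inc (g (ends e').1); have := inc (g (ends e').2).
rewrite !gK !incident_ends !eqxx !orbT /= => /esym/orP h2 /esym/orP h1 /orP k2 /orP k1.
rewrite [ends e']surjective_pairing.
by case: h1 => /eqP/(canRL gK) h1; case: h2 => /eqP/(canRL gK) h2; rewrite h1 h2 in k1 k2 *;
  case: k1 => /eqP k1; case: k2 => /eqP k2; rewrite ?k1 ?k2; auto.
Qed.

Local Close Scope ring_scope.
Local Open Scope nat_scope.

(** * Subdivisions of graphs *)

Definition joins (X : multigraph) (e : edge X) (u v : vertex X) :=
  ends e = (u, v) \/ ends e = (v, u).

(** X arises from Y by subdividing each edge c into a path of [path_length c]
    edges, with vertices [path_vertex c 0], ..., [path_vertex c (path_length c)];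
    [path_edge c i] joins [path_vertex c i] and [path_vertex c i.+1].  Values at
    indices beyond the length of the path are arbitrary. *)
Record subdivision (X Y : multigraph) := Subdivision {
  path_length : edge Y -> nat;
  branch_vertex : vertex Y -> vertex X;
  path_vertex : edge Y -> nat -> vertex X;
  path_edge : edge Y -> nat -> edge X;
  path_class : edge X -> edge Y;
  path_length_gt0 : forall c, 0 < path_length c;
  path_start : forall c, path_vertex c 0 = branch_vertex (ends c).1;
  path_end : forall c, path_vertex c (path_length c) = branch_vertex (ends c).2;
  path_edge_joins : forall c i, i < path_length c ->
    joins (path_edge c i) (path_vertex c i) (path_vertex c i.+1);
  path_edge_inj : forall c i j, i < path_length c -> j < path_length c ->
    path_edge c i = path_edge c j -> i = j;
  path_edge_surj : forall e, exists2 i, i < path_length (path_class e) &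
    path_edge (path_class e) i = e;
  path_edge_class : forall c i, i < path_length c -> path_class (path_edge c i) = c;
  branch_vertex_inj : injective branch_vertex;
  path_vertex_inj : forall c d i j, 0 < i < path_length c -> 0 < j < path_length d ->
    path_vertex c i = path_vertex d j -> (c, i) = (d, j);
  path_vertex_neq_branch : forall c i y, 0 < i < path_length c ->
    path_vertex c i <> branch_vertex y;
  vertex_cover : forall v, (exists y, v = branch_vertex y) \/
    (exists c i, 0 < i < path_length c /\ v = path_vertex c i) }.

Lemma bijective_of_inj_surj (T U : Type) (f : T -> U) :
  injective f -> (forall y, exists x, f x = y) -> bijective f.
Proof.
move=> finj /choice[g fg]; exists g => // x; exact/finj/fg.
Qed.

Section SubdivisionIso.
Variables (X X' Y Y' : multigraph) (s : subdivision X Y) (s' : subdivision X' Y').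
Variables (f : vertex Y -> vertex Y') (phi : edge Y -> edge Y').
Hypotheses (f_bij : bijective f) (phi_bij : bijective phi).
Hypothesis phi_joins : forall c, joins (phi c) (f (ends c).1) (f (ends c).2).
Hypothesis phi_length : forall c, path_length s' (phi c) = path_length s c.

(* The edge phi c may run against the direction of c, and then the path over c is
   traversed backwards. *)
Let flip c := ends (phi c) != (f (ends c).1, f (ends c).2).
Let edge_index c i := if flip c then path_length s c - i.+1 else i.
Let vertex_index c i := if flip c then path_length s c - i else i.

Lemma edge_indexK c i : i < path_length s c -> edge_index c (edge_index c i) = i.
Proof. by rewrite /edge_index; case: (flip c) => // lt_i; lia. Qed.

Lemma edge_index_lt c i : i < path_length s c -> edge_index c i < path_length s c.
Proof. by rewrite /edge_index; case: (flip c) => // lt_i; lia. Qed.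

Lemma vertex_indexK c i : i <= path_length s c -> vertex_index c (vertex_index c i) = i.
Proof. by rewrite /vertex_index; case: (flip c) => // lt_i; lia. Qed.

Lemma vertex_index_lt c i : 0 < i < path_length s c -> 0 < vertex_index c i < path_length s c.
Proof. by rewrite /vertex_index; case: (flip c) => // lt_i; lia. Qed.

Lemma subdivision_iso : graph_iso X X'.
Proof.
have phi_inj := bij_inj phi_bij; have f_inj := bij_inj f_bij.
have [psi phiK psiK] := phi_bij; have [g fK gK] := f_bij.
have /choice[index indexP] :
    forall e, exists i, i < path_length s (path_class s e) /\ path_edge s (path_class s e) i = e.
  by move=> e; have [i ] := path_edge_surj s e; exists i.
have index_lt e := proj1 (indexP e); have indexE e := proj2 (indexP e).
pose F e := path_edge s' (phi (path_class s e)) (edge_index (path_class s e) (index e)).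
have F_path c i : i < path_length s c -> F (path_edge s c i) = path_edge s' (phi c) (edge_index c i).
  move=> lt_i; have ec := path_edge_class lt_i; rewrite /F ec.
  have := indexE (path_edge s c i); have := index_lt (path_edge s c i); rewrite ec => lt_j.
  by move=> /(path_edge_inj lt_j lt_i) ->.
have /choice[code codeP] : forall v, exists w : vertex Y + edge Y * nat,
    match w with
    | inl y => v = branch_vertex s y
    | inr ci => 0 < ci.2 < path_length s ci.1 /\ v = path_vertex s ci.1 ci.2
    end.
  by move=> v; case: (vertex_cover s v) => [[y ->]|[c [i [lt_i ->]]]];
    [exists (inl y)|exists (inr (c, i))].
pose G v := match code v with
  | inl y => branch_vertex s' (f y)
  | inr ci => path_vertex s' (phi ci.1) (vertex_index ci.1 ci.2)
  end.
have G_branch y : G (branch_vertex s y) = branch_vertex s' (f y).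
  rewrite /G; have := codeP (branch_vertex s y); case: (code _) => [z|[c i] [lt_i]].
    by move=> /branch_vertex_inj ->.
  by move=> e; case: (path_vertex_neq_branch lt_i (esym e)).
have G_inner c i : 0 < i < path_length s c ->
    G (path_vertex s c i) = path_vertex s' (phi c) (vertex_index c i).
  move=> lt_i; rewrite /G; have := codeP (path_vertex s c i).
  case: (code _) => [z e|[d j] [lt_j]]; first by case: (path_vertex_neq_branch lt_i e).
  by move=> /(path_vertex_inj lt_i lt_j)[-> ->].
have G_path c i : i <= path_length s c ->
    G (path_vertex s c i) = path_vertex s' (phi c) (vertex_index c i).
  move=> le_i; have [lt_i|] := boolP (0 < i < path_length s c); first exact: G_inner.
  have flipE : ends (phi c) = if flip c then (f (ends c).2, f (ends c).1)
                              else (f (ends c).1, f (ends c).2).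
    by rewrite /flip; case: eqP => //= ne; case: (phi_joins c).
  have l0 := path_length_gt0 s c.
  move=> end_i; have [->|i0] := eqVneq i 0.
    rewrite path_start G_branch /vertex_index; move: flipE; case: (flip c) => flipE.
      by rewrite subn0 -phi_length path_end flipE.
    by rewrite path_start flipE.
  have -> : i = path_length s c by lia.
  rewrite path_end G_branch /vertex_index; move: flipE; case: (flip c) => flipE.
    by rewrite subnn path_start flipE.
  by rewrite -phi_length path_end flipE.
exists G, F; split.
- apply: bijective_of_inj_surj => [u v|v'].
    case: (vertex_cover s u) => [[y ->]|[c [i [lt_i ->]]]];
    case: (vertex_cover s v) => [[z ->]|[d [j [lt_j ->]]]]; rewrite ?G_branch ?G_inner //.
    + by move=> /branch_vertex_inj/f_inj ->.
    + move=> /esym e; have := @path_vertex_neq_branch _ _ s' (phi d) _ _ _ e.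
      by rewrite phi_length => /(_ (vertex_index_lt lt_j)).
    + move=> e; have := @path_vertex_neq_branch _ _ s' (phi c) _ _ _ e.
      by rewrite phi_length => /(_ (vertex_index_lt lt_i)).
    move=> e; have := @path_vertex_inj _ _ s' _ _ _ _ _ _ e.
    rewrite !phi_length => /(_ (vertex_index_lt lt_i) (vertex_index_lt lt_j)) [/phi_inj cd].
    rewrite -cd in lt_j * => /(congr1 (vertex_index c)); rewrite !vertex_indexK; first by move->.
      by case/andP: lt_j => _ /ltnW.
    by case/andP: lt_i => _ /ltnW.
  case: (vertex_cover s' v') => [[y ->]|[c [i [lt_i ->]]]].
    by exists (branch_vertex s (g y)); rewrite G_branch gK.
  rewrite -(psiK c) phi_length in lt_i *.
  exists (path_vertex s (psi c) (vertex_index (psi c) i)).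
  rewrite G_inner ?vertex_index_lt // vertex_indexK //.
  by case/andP: lt_i => _ /ltnW.
- apply: bijective_of_inj_surj => [d e|e'].
    rewrite -[d]indexE -[e]indexE !F_path //.
    set c := path_class s d; set c' := path_class s e => eq_F.
    have cc' : c = c'.
      apply: phi_inj; have := @path_edge_class _ _ s' (phi c) (edge_index c (index d)).
      rewrite eq_F phi_length edge_index_lt ?index_lt // => /(_ isT) <-.
      by rewrite path_edge_class // phi_length edge_index_lt ?index_lt.
    have lt_d := index_lt d; have lt_e := index_lt e; rewrite -/c -/c' -cc' in lt_d lt_e eq_F *.
    have := @path_edge_inj _ _ s' (phi c) _ _ _ _ eq_F.
    rewrite phi_length !edge_index_lt // => /(_ isT isT)/(congr1 (edge_index c)).
    by rewrite !edge_indexK // => ->.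
  have [i ] := path_edge_surj s' e'; rewrite -(psiK (path_class s' e')) phi_length => lt_i <-.
  exists (path_edge s (psi (path_class s' e')) (edge_index (psi (path_class s' e')) i)).
  by rewrite F_path ?edge_index_lt // edge_indexK.
move=> e; rewrite -[e]indexE F_path //=.
set c := path_class s e; set i := index e; have lt_i : i < path_length s c := index_lt e.
have lt_i' := edge_index_lt lt_i; rewrite -phi_length in lt_i'.
have i_joins := path_edge_joins lt_i; have i'_joins := path_edge_joins lt_i'.
have [Gi Gi1] := (G_path c i (ltnW lt_i), G_path c i.+1 lt_i).
have : joins (path_edge s' (phi c) (edge_index c i))
             (G (path_vertex s c i)) (G (path_vertex s c i.+1)).
  move: i'_joins; rewrite Gi Gi1 /joins /edge_index /vertex_index; case: (flip c) => //.
  by rewrite -subSn // subSS => -[->|->]; [right|left].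
by rewrite /swap; case: i_joins => ->; case=> -> /=; auto.
Qed.

End SubdivisionIso.

Lemma joinsC (X : multigraph) (e : edge X) u v : joins e u v -> joins e v u.
Proof. by case; [right|left]. Qed.

Lemma incidence_joins (X : multigraph) (e : edge X) u v w : joins e u v ->
  incidence e w = (u == w) + (v == w).
Proof. by rewrite /incidence => -[->|->] //=; rewrite addnC. Qed.

(** * Contracting an edge at a vertex of degree 2 *)

Section Contraction.
Variables (X : multigraph) (v x y : vertex X) (e g : edge X).
Hypotheses (eg : e != g) (e_joins : joins e v x) (g_joins : joins g v y).
Hypotheses (xv : x != v) (yv : y != v).
Hypothesis only_eg : forall h, incident_to h v -> (h == e) || (h == g).

Implicit Type R : {set edge X}.

(** The default value is never reached by the ends of an edge of the contraction. *)
Definition contraction_vertex (w : vertex X) : {w : vertex X | w != v} :=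
  insubd (exist _ x xv) w.

(** The vertex v lies between x and y.  It disappears together with e, and g takes
    over the path from x to y. *)
Definition contraction : multigraph := @Multigraph
  {w : vertex X | w != v} {h : edge X | h != e}
  (fun h => let p := if val h == g then (x, y) else ends (val h) in
            (contraction_vertex p.1, contraction_vertex p.2)).

Lemma contraction_ends_val (h : edge contraction) : val h != g ->
  val (ends h).1 = (ends (val h)).1 /\ val (ends h).2 = (ends (val h)).2.
Proof.
move=> hg; rewrite /= (negbTE hg) /=.
have ends_v : forall w, incident_to (val h) w -> w != v.
  move=> w; apply: contraTneq => ->.
  by apply/negP => /only_eg; rewrite (negbTE hg) (negbTE (valP h)).
by rewrite !val_insubd !ends_v // incident_ends eqxx ?orbT.
Qed.

Lemma contraction_ends_g (h : edge contraction) : val h = g ->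
  val (ends h).1 = x /\ val (ends h).2 = y.
Proof. by move=> hg; rewrite /= hg eqxx /= !val_insubd xv yv. Qed.

Lemma contraction_incidence (h : edge contraction) (w : vertex contraction) :
  incidence h w = if val h == g then incidence e (val w) + incidence g (val w)
                  else incidence (val h) (val w).
Proof.
have vw : (v == val w) = false by rewrite eq_sym; apply/negbTE/(valP w).
rewrite /incidence -!val_eqE; case: (eqVneq (val h) g) => [hg|hg].
  rewrite -/(incidence e _) -/(incidence g _) (incidence_joins _ e_joins) (incidence_joins _ g_joins) vw.
  by have [-> ->] := contraction_ends_g hg.
by have [-> ->] := contraction_ends_val hg.
Qed.

Lemma incidence_e_v : incidence e v = 1.
Proof. by rewrite (incidence_joins _ e_joins) eqxx (negbTE xv). Qed.

Lemma incidence_g_v : incidence g v = 1.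
Proof. by rewrite (incidence_joins _ g_joins) eqxx (negbTE yv). Qed.

Lemma degree_in_v R : degree_in R v = (e \in R) + (g \in R).
Proof.
rewrite /degree_in big_mkcond (bigD1 e) //= (bigD1 g) 1?eq_sym //=.
rewrite incidence_e_v incidence_g_v big1 ?addn0; first by do 2!case: (_ \in R).
move=> h /andP[he hg]; case: ifP => // _; apply/eqP; rewrite -leqn0 leqNgt.
by apply/negP => /only_eg; rewrite (negbTE he) (negbTE hg).
Qed.

Definition contraction_set (R : {set edge X}) : {set edge contraction} := [set h | val h \in R].

Lemma contraction_degree_in R (w : vertex contraction) : (e \in R) = (g \in R) ->
  degree_in (contraction_set R) w = degree_in R (val w).
Proof.
move=> eR; rewrite /degree_in [RHS]big_mkcond (bigD1 e) //=.
rewrite [X in _ + X](reindex (val : edge contraction -> edge X)) /=; last first.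
  exists (insubd (exist _ g (introN eqP (fun ge => elimN eqP eg (esym ge))) : edge contraction)).
    by move=> h _; rewrite valKd.
  by move=> h; rewrite inE => he; rewrite val_insubd he.
rewrite [X in _ + X](eq_bigl xpredT) => [|h]; last exact: (valP h).
have ge : g != e by rewrite eq_sym.
pose g' : edge contraction := exist _ g ge.
rewrite [LHS]big_mkcond (bigD1 g') //= [in RHS](bigD1 g') //= inE /= contraction_incidence eqxx eR.
have -> : \sum_(i : edge contraction | i != g') (if i \in contraction_set R then incidence i w else 0)
   = \sum_(i : edge contraction | i != g') (if val i \in R then incidence (val i) (val w) else 0).
  apply: eq_bigr => h; rewrite -val_eqE /= => hg.
  by rewrite inE contraction_incidence (negbTE hg).
by case: ifP => _; rewrite ?add0n // addnA.
Qed.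

Lemma contraction_degree (w : vertex contraction) : degree w = degree (val w).
Proof.
rewrite -!degree_inT -contraction_degree_in ?inE //.
by congr degree_in; apply/setP => h; rewrite !inE.
Qed.

Lemma contraction_md2 : md2 X -> md2 contraction.
Proof. by move=> md w; rewrite contraction_degree. Qed.

Lemma degree_prod_separated R : (e \in R) != (g \in R) -> degree_prod R = 0%R.
Proof.
move=> eR; apply/eqP; rewrite -[_ == _]negbK degree_prod_neq0; apply/forallPn; exists v.
by rewrite negbK degree_in_v; move: eR; do 2!case: (_ \in R).
Qed.

Lemma prod_contraction (F : vertex X -> int) :
  (\prod_w F w = F v * \prod_(w : vertex contraction) F (val w))%R.
Proof.
rewrite (bigD1 v) //=; congr (_ * _)%R.
rewrite (reindex (val : vertex contraction -> vertex X)) /=; last first.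
  exists contraction_vertex; first by move=> h _; rewrite /contraction_vertex valKd.
  by move=> h; rewrite inE => he; rewrite /contraction_vertex val_insubd he.
by apply: eq_bigl => w; rewrite (valP w).
Qed.

(** The vertex v contributes 1 - 2 or 1 - 0, and the other degrees are unchanged. *)
Lemma degree_prod_contraction R : (e \in R) = (g \in R) ->
  (degree_prod R = (-1) ^+ (e \in R) * degree_prod (contraction_set R))%R.
Proof.
move=> eR; rewrite /degree_prod prod_contraction degree_in_v -eR; congr (_ * _)%R.
  by case: (e \in R).
by apply: eq_bigr => w _; rewrite contraction_degree_in.
Qed.

Lemma card_contraction_set R : #|R| = (e \in R) + #|contraction_set R|.
Proof.
rewrite (cardsD1 e); congr (_ + _); rewrite -(card_imset _ val_inj).
apply: eq_card => h; rewrite !inE; apply/andP/imsetP => [[he hR]|[k]].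
  by exists (exist _ h he); rewrite ?inE.
by rewrite inE => kR ->; split=> //; apply: (valP k).
Qed.

Section Insertion.
Variables (Y : multigraph) (t : subdivision contraction Y).

Let g' : edge contraction := exist _ g (introN eqP (fun ge => elimN eqP eg (esym ge))).
Let c0 := path_class t g'.

Lemma val_path_edge_neq c k i : i < path_length t c0 -> path_edge t c0 i = g' ->
  k < path_length t c -> (c, k) <> (c0, i) ->
  val (path_edge t c k) != e /\ val (path_edge t c k) != g.
Proof.
move=> lt_i ei lt_k ck; split; first exact: (valP (path_edge t c k)).
apply/eqP => kg; apply: ck.
have eg' : path_edge t c k = g' by apply: val_inj.
have cc0 : c = c0 by rewrite -(path_edge_class lt_k) eg'.
by rewrite cc0 in lt_k eg' *; rewrite (path_edge_inj lt_k lt_i) // eg'.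
Qed.

Lemma joins_val c k : k < path_length t c -> val (path_edge t c k) != g ->
  joins (val (path_edge t c k)) (val (path_vertex t c k)) (val (path_vertex t c k.+1)).
Proof.
move=> lt_k kg; have := path_edge_joins lt_k; have [] := contraction_ends_val kg.
move=> h1 h2; rewrite /joins [ends (val _)]surjective_pairing -h1 -h2.
by case=> ->; auto.
Qed.

(** The path through g gets the vertex v at position i + 1, and the two edges e and
    g, in the order that fits the direction of the path, at positions i and i + 1;
    later positions move up by one. *)
Lemma subdivision_insert : exists s : subdivision X Y,
  forall h, path_class s h = path_class t (insubd g' h).
Proof.
have [i lt_i ei] := path_edge_surj t g'; rewrite -/c0 in lt_i ei.
have [e1 [e2 [e12 j1 j2]]] : exists e1 e2,
    [/\ e1 = e /\ e2 = g \/ e1 = g /\ e2 = e, joins e1 (val (path_vertex t c0 i)) v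
      & joins e2 v (val (path_vertex t c0 i.+1))].
  have := path_edge_joins lt_i; rewrite ei.
  have [] := contraction_ends_g (erefl g : val g' = g).
  move=> e1 e2 [] ends_g; rewrite ends_g in e1 e2.
    exists e, g; have -> : val (path_vertex t c0 i) = x := e1.
    have -> : val (path_vertex t c0 i.+1) = y := e2.
    by split; [left|exact: joinsC|].
  exists g, e; have -> : val (path_vertex t c0 i.+1) = x := e1.
  have -> : val (path_vertex t c0 i) = y := e2.
  by split; [right|exact: joinsC|].
have ne12 : e1 != e2 by case: e12 => -[-> ->]; rewrite // eq_sym.
(* The former position of what is now at position k, for k <> i + 1. *)
pose low k := if k <= i then k else k.-1.
pose pl c := if c == c0 then (path_length t c).+1 else path_length t c.
pose pv c k := if c == c0 then if k == i.+1 then v else val (path_vertex t c (low k))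
               else val (path_vertex t c k).
pose pe c k := if c == c0 then if k == i.+1 then e2 else if k == i then e1
                 else val (path_edge t c (low k))
               else val (path_edge t c k).
have edge_cases c k : k < pl c ->
  [\/ [/\ c = c0, k = i.+1 & pe c k = e2], [/\ c = c0, k = i & pe c k = e1] |
      exists j, [/\ j < path_length t c, (c, j) <> (c0, i), pe c k = val (path_edge t c j),
                    pv c k = val (path_vertex t c j) /\ pv c k.+1 = val (path_vertex t c j.+1)
                  & k = if c == c0 then if j < i then j else j.+1 else j]].
  rewrite /pl /pe /pv; case: (eqVneq c c0) => [->|cc0] lt_k.
    have [->|ki1] := eqVneq k i.+1; first by constructor 1.
    have [->|ki] := eqVneq k i; first by constructor 2.
    constructor 3; exists (low k); rewrite eqSS (negbTE ki) /low.
    case: (ltngtP k i) ki ki1 => // ki _ ki1; split=> //; try by case; lia.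
    - by lia.
    - by rewrite ki.
    - by lia.
    - by rewrite (ltn_predK ki).
    by case: ifP; lia.
  by constructor 3; exists k; split=> // -[] /eqP; rewrite (negbTE cc0).
have vertex_cases c k : 0 < k < pl c ->
  [/\ c = c0, k = i.+1 & pv c k = v] \/
  exists j, [/\ 0 < j < path_length t c, pv c k = val (path_vertex t c j)
              & k = if c == c0 then if j <= i then j else j.+1 else j].
  rewrite /pl /pv; case: (eqVneq c c0) => [->|cc0] lt_k; last by right; exists k.
  have [->|ki1] := eqVneq k i.+1; first by left.
  right; exists (low k); rewrite /low; case: ifP => ki; split=> //; try lia.
    by rewrite ki.
  by case: ifP; lia.
have val_neq c j : j < path_length t c -> (c, j) <> (c0, i) ->
    [/\ val (path_edge t c j) != e1, val (path_edge t c j) != e2 & val (path_edge t c j) != g].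
  move=> lt_j ne; have [he hg] := val_path_edge_neq lt_i ei lt_j ne.
  by split=> //; case: e12 => -[e1E e2E]; rewrite ?e1E ?e2E.
have insub_eg : insubd g' e = g' /\ insubd g' g = g'.
  by split; apply: val_inj; rewrite val_insubd ?eqxx //= eq_sym eg.
have insub12 : insubd g' e1 = g' /\ insubd g' e2 = g'.
  by case: insub_eg e12 => ? ? [[-> ->]|[-> ->]].
have class_pe c k : k < pl c -> path_class t (insubd g' (pe c k)) = c.
  case/edge_cases => [[-> _ ->]|[-> _ ->]|[j [lt_j _ -> _ _]]].
  - by case: insub12 => _ ->.
  - by case: insub12 => ->.
  by rewrite valKd path_edge_class.
have low_end c : pv c (pl c) = val (path_vertex t c (path_length t c)).
  rewrite /pv /pl /low; case: eqP => [->|//]; rewrite eqSS.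
  have -> : (path_length t c0 == i) = false by lia.
  by have -> : (path_length t c0 < i) = false by lia.
have exists_s : exists s : subdivision X Y, path_class s = fun h => path_class t (insubd g' h).
  unshelve refine (ex_intro _ (@Subdivision X Y pl (fun y => val (branch_vertex t y)) pv pe
    (fun h => path_class t (insubd g' h)) _ _ _ _ _ _ _ _ _ _ _) erefl).
  - by move=> c; rewrite /pl; case: eqP => // _; apply: path_length_gt0.
  - by move=> c; rewrite /pv /low /= -path_start; case: eqP => // ->.
  - by move=> c; rewrite low_end path_end.
  - move=> c k lt_k; case: (edge_cases c k lt_k) => [[-> -> ->]|[-> -> ->]|[j [lt_j ne -> [-> ->] _]]].
    + rewrite /pv !eqxx /low eqSS; have -> : (i.+1 == i) = false by lia.
      by have -> : (i.+2 <= i) = false by lia.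
    + rewrite /pv !eqxx /low leqnn; have -> : (i == i.+1) = false by lia.
      exact: j1.
    by apply: joins_val => //; have [] := val_neq _ _ lt_j ne.
  - move=> c k l lt_k lt_l.
    case: (edge_cases c k lt_k) => [[c1 -> ->]|[c1 -> ->]|[j [lt_j ne -> _ ->]]];
    case: (edge_cases c l lt_l) => [[c2 -> ->]|[c2 -> ->]|[m [lt_m ne' -> _ ->]]] //.
    + by move=> e21; rewrite e21 eqxx in ne12.
    + by move=> e21; have [_] := val_neq _ _ lt_m ne'; rewrite -e21 eqxx.
    + by move=> e21; rewrite e21 eqxx in ne12.
    + by move=> e21; have [] := val_neq _ _ lt_m ne'; rewrite -e21 eqxx.
    + by move=> e21; have [_] := val_neq _ _ lt_j ne; rewrite e21 eqxx.
    + by move=> e21; have [] := val_neq _ _ lt_j ne; rewrite e21 eqxx.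
    by move=> /val_inj/(path_edge_inj lt_j lt_m) ->.
  - have i_lt : i < pl c0 by rewrite /pl eqxx ltnW.
    have i1_lt : i.+1 < pl c0 by rewrite /pl eqxx ltnS.
    have pe_i : pe c0 i = e1 by rewrite /pe !eqxx; have -> : (i == i.+1) = false by lia.
    have pe_i1 : pe c0 i.+1 = e2 by rewrite /pe !eqxx.
    move=> h; have [->|he1] := eqVneq h e1.
      by exists i; case: insub12 => ->.
    have [->|he2] := eqVneq h e2.
      by exists i.+1; case: insub12 => _ ->.
    have he : h != e by case: e12 he1 he2 => -[-> ->].
    have [j lt_j ej] := path_edge_surj t (insubd g' h).
    have vh : val (insubd g' h) = h by rewrite val_insubd he.
    set c := path_class _ _ in lt_j ej *.
    have ne : (c, j) <> (c0, i).
      move=> [cc ji]; have : h = g by rewrite -vh -ej cc ji ei.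
      by move=> hg; case: e12 he1 he2 => -[-> ->]; rewrite hg eqxx.
    exists (if c == c0 then if j < i then j else j.+1 else j).
      by rewrite /pl; case: ifP => // _; case: ifP; lia.
    rewrite /pe /low -[in RHS]vh -ej; case: (eqVneq c c0) => [cc|//].
    have ji : j != i by apply/eqP => ji; apply: ne; rewrite cc ji.
    case: (ltngtP j i) ji => // ji _.
      have -> : (j == i.+1) = false by lia.
      have -> : (j == i) = false by lia.
      by rewrite (ltnW ji).
    have -> : (j.+1 == i.+1) = false by lia.
    have -> : (j.+1 == i) = false by lia.
    by have -> : (j.+1 <= i) = false by lia.
  - exact: class_pe.
  - by move=> z1 z2 /val_inj eb; apply: (@branch_vertex_inj _ _ t).
  - move=> c d k l lt_k lt_l.
    case: (vertex_cases c k lt_k) => [[-> -> ->]|[j [lt_j -> ->]]];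
    case: (vertex_cases d l lt_l) => [[-> -> ->]|[m [lt_m -> ->]]] //.
    + by move=> ev; have := valP (path_vertex t d m); rewrite -ev eqxx.
    + by move=> ev; have := valP (path_vertex t c j); rewrite ev eqxx.
    by move=> /val_inj/(path_vertex_inj lt_j lt_m)[-> ->].
  - move=> c k z lt_k; case: (vertex_cases c k lt_k) => [[_ _ ->]|[j [lt_j -> _]]].
      by move=> ev; have := valP (branch_vertex t z); rewrite -ev eqxx.
    by move=> /val_inj eb; apply: (path_vertex_neq_branch lt_j eb).
  move=> w; have [->|wv] := eqVneq w v.
    right; exists c0, i.+1; rewrite /pl /pv !eqxx; split=> //.
  case: (vertex_cover t (exist _ w wv)) => [[z wz]|[c [j [lt_j wj]]]].
    by left; exists z; rewrite -wz.
  right; exists c, (if c == c0 then if j <= i then j else j.+1 else j); split.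
    by rewrite /pl; case: ifP => // _; case: ifP; lia.
  rewrite /pv /low; case: (eqVneq c c0) => [_|_]; last by rewrite -wj.
  case: (leqP j i) => ji.
    have -> : (j == i.+1) = false by lia.
    by rewrite ji -wj.
  have -> : (j.+1 == i.+1) = false by lia.
  have -> : (j.+1 <= i) = false by lia.
  by rewrite /= -wj.
by have [s sE] := exists_s; exists s => h; rewrite sE.
Qed.

End Insertion.

End Contraction.

(** * Every md2 graph subdivides a reduced one *)

Lemma joins_of_incidence (X : multigraph) (e : edge X) v : incidence e v = 1 ->
  exists2 x, x != v & joins e v x.
Proof.
rewrite /incidence /joins; case: (ends e) => a b /=.
case: (eqVneq a v) => [->|av]; case: (eqVneq b v) => [->|bv] //= _.
  by exists b; [|left].
by exists a; [|right].
Qed.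

Lemma contractible_of_not_reduced (X : multigraph) : md2 X -> ~ reduced X ->
  exists v x y (e g : edge X), [/\ e != g, joins e v x, joins g v y, x != v & y != v] /\
    forall h, incident_to h v -> (h == e) || (h == g).
Proof.
move=> md /existsNP[e /existsNP[v /not_implyP[le /not_implyP[ev /negP]]]].
rewrite -ltnNge => deg3; have deg2 := md v.
have ie : incidence e v = 1 by rewrite incidence_nonloop // ev.
have : \sum_(h | h != e) incidence h v == 1.
  have : degree v = incidence e v + \sum_(h | h != e) incidence h v.
    rewrite -degree_inT /degree_in (bigD1 e) ?inE //=; congr (_ + _).
    by apply: eq_bigl => h; rewrite inE.
  by lia.
case/sum_nat_eq1 => g [ge ig other].
have [x xv ex] := joins_of_incidence ie; have [y yv gy] := joins_of_incidence ig.
exists v, x, y, e, g; split; first by rewrite eq_sym.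
move=> h; apply: contraTT; rewrite negb_or => /andP[he hg].
by rewrite /incident_to other.
Qed.

Section TrivialSubdivision.
Variable X : multigraph.

Lemma subdivision_refl : exists s : subdivision X X, path_class s = id.
Proof.
have lt1 i : i < 1 -> i = 0 by case: i.
unshelve refine (ex_intro _ (@Subdivision X X (fun=> 1) id
  (fun c i => if i == 0 then (ends c).1 else (ends c).2) (fun c _ => c) id
  _ _ _ _ _ _ _ _ _ _ _) erefl) => //.
- by move=> c i /lt1->; left; rewrite /= -surjective_pairing.
- by move=> c i j /lt1-> /lt1->.
- by move=> e; exists 0.
- by move=> c d i j; case: i => [|[]].
- by move=> c i y; case: i => [|[]].
by move=> v; left; exists v.
Qed.

End TrivialSubdivision.

(** The sign compensates the factor -1 of a vertex of degree 2, so that the value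
    does not change under contraction. *)
Definition signed_degree_prod (X : multigraph) (R : {set edge X}) : int :=
  ((-1) ^+ #|R| * degree_prod R)%R.

(** Contract edges at vertices of degree 2 as long as possible.  A set of edges that
    separates the two edges at such a vertex has a vertex of degree 1 there. *)
Lemma exists_reduction (X : multigraph) : md2 X ->
  exists (Y : multigraph) (s : subdivision X Y),
  [/\ md2 Y, reduced Y,
      forall R : {set edge X}, degree_prod R != 0 ->
        forall e h, path_class s e = path_class s h -> (e \in R) = (h \in R) &
      forall S : {set edge Y},
        signed_degree_prod (path_class s @^-1: S) = signed_degree_prod S].
Proof.
have [n] := ubnP #|edge X|; elim: n => // n IH in X *; move=> lt_n md.
have [red|nred] := pselect (reduced X).
  have [s sE] := subdivision_refl X; exists X, s; rewrite sE; split=> //.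
    by move=> R _ e h ->.
  by move=> S; congr signed_degree_prod; apply/setP => e; rewrite inE.
have [v [x [y [e [g [[eg ev gv xv yv] only]]]]]] := contractible_of_not_reduced md nred.
pose Z := contraction y e g xv.
have [|Y [t [mdY redY tS tW]]] := IH Z _ (contraction_md2 eg ev gv yv only md).
  have : #|edge Z| < #|edge X|.
    rewrite card_sig; apply/proper_card/properP.
    by split; [exact/subsetP|exists e; rewrite ?inE ?eqxx].
  by lia.
have [s sE] := subdivision_insert eg ev gv yv only t.
exists Y, s.
set g' := exist _ g _ in sE.
have same_class : path_class s e = path_class s g.
  rewrite !sE; congr (path_class t _); apply: val_inj.
  by rewrite !val_insubd eqxx /= eq_sym eg.
split=> // [R R0 h1 h2|S].
  have eR : (e \in R) = (g \in R).
    by apply/eqP; apply: contraNT R0 => ne; rewrite (degree_prod_separated eg ev gv xv yv only ne).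
  have memR h : (h \in R) = (insubd g' h \in contraction_set y e g xv R).
    rewrite inE val_insubd; case: eqVneq => [->|] //=.
  rewrite !sE !memR; apply: tS.
  apply: contraNneq R0; rewrite (degree_prod_contraction eg ev gv xv yv only eR) => ->.
  by rewrite mulr0.
rewrite -tW /signed_degree_prod.
set R := _ @^-1: S.
have eR : (e \in R) = (g \in R) by rewrite !inE same_class.
have -> : path_class t @^-1: S = contraction_set y e g xv R.
  by apply/setP => h; rewrite !inE sE valKd.
rewrite (degree_prod_contraction eg ev gv xv yv only eR) (card_contraction_set y e g xv).
by case: (e \in R); rewrite exprD ?expr1 ?expr0; ring.
Qed.

(** * The products of degrees determine the graph *)

Lemma signed_degree_prod_eq0 (X : multigraph) (R : {set edge X}) :
  (signed_degree_prod R == 0%R) = (degree_prod R == 0%R).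
Proof. by rewrite /signed_degree_prod mulf_eq0 expf_eq0 andbF. Qed.

(** Remove c from the whole graph; if c is a loop, take c alone instead, because
    removing a loop at a vertex of degree 3 leaves degree 1. *)
Lemma reduced_separation (Y : multigraph) (c d : edge Y) : md2 Y -> reduced Y -> c != d ->
  exists2 S : {set edge Y}, degree_prod S != 0%R & (c \in S) != (d \in S).
Proof.
move=> md red cd; have [lc|lc] := boolP (loop c).
  by exists [set c]; rewrite -?loopE // !inE eqxx [d == c]eq_sym (negbTE cd).
exists (~: [set c]); last by rewrite !inE eqxx [d == c]eq_sym (negbTE cd).
rewrite degree_prod_neq0; apply/forallP => v.
have := degree_inC [set c] v; rewrite degree_in1 incidence_nonloop //.
case: (boolP (incident_to c v)) => cv; first by have := red c v lc cv; lia.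
by have := md v; lia.
Qed.

(** Paths are recovered from the sets of edges with nonzero product: these do not
    cut a path, and they separate distinct paths. *)
Lemma path_class_eq (X Y : multigraph) (s : subdivision X Y) : md2 Y -> reduced Y ->
  (forall R : {set edge X}, degree_prod R != 0%R ->
     forall e h, path_class s e = path_class s h -> (e \in R) = (h \in R)) ->
  (forall S : {set edge Y}, signed_degree_prod (path_class s @^-1: S) = signed_degree_prod S) ->
  forall e h, path_class s e = path_class s h <->
    forall R : {set edge X}, degree_prod R != 0%R -> (e \in R) = (h \in R).
Proof.
move=> md red sat weight e h; split=> [eh R /sat/(_ _ _ eh) //|same].
apply/eqP; apply: contraT => /(reduced_separation md red)[S S0 /negP[]]; apply/eqP.
have := same (path_class s @^-1: S); rewrite !inE; apply.
by rewrite -signed_degree_prod_eq0 weight signed_degree_prod_eq0.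
Qed.

Lemma path_lengthE (X Y : multigraph) (s : subdivision X Y) c :
  path_length s c = #|[set e | path_class s e == c]|.
Proof.
pose f (i : 'I_(path_length s c)) := path_edge s c i.
have f_inj : injective f by move=> i j ij; apply: val_inj; apply: path_edge_inj ij.
rewrite -[LHS]card_ord -(card_imset _ f_inj).
apply: eq_card => e; rewrite !inE; apply/imsetP/eqP => [[i _ ->]|ec].
  exact: path_edge_class.
have [i ] := path_edge_surj s e; rewrite ec => lt_i ei.
by exists (Ordinal lt_i).
Qed.

(** By [path_class_eq], phi preserves the relation of lying on the same subdivided
    path, so it induces a bijection rho between the edges of the reduced graphs,
    compatible with lengths and products. *)
Theorem iso_of_degree_prod (X X' : multigraph) (phi : edge X -> edge X') :
  md2 X -> md2 X' -> bijective phi ->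
  (forall R : {set edge X}, degree_prod (phi @: R) = degree_prod R) -> graph_iso X X'.
Proof.
move=> md md' phi_bij phi_prod; have phi_inj := bij_inj phi_bij.
have [psi phiK psiK] := phi_bij.
have [Y [s [mdY redY sat weight]]] := exists_reduction md.
have [Y' [s' [mdY' redY' sat' weight']]] := exists_reduction md'.
have same_class := path_class_eq mdY redY sat weight.
have same_class' := path_class_eq mdY' redY' sat' weight'.
have phi_class e h : path_class s e = path_class s h <->
    path_class s' (phi e) = path_class s' (phi h).
  rewrite same_class same_class'; split=> same R R0; last first.
    by have := same (phi @: R); rewrite phi_prod !(mem_imset _ _ phi_inj); apply.
  have RE : R = phi @: (phi @^-1: R).
    by apply/setP => f; rewrite -[f]psiK (mem_imset _ _ phi_inj) inE.
  have := same (phi @^-1: R); rewrite !inE; apply.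
  by rewrite -phi_prod -RE.
pose first c := path_edge s c 0.
have firstE c : path_class s (first c) = c by apply/path_edge_class/path_length_gt0.
pose rho c := path_class s' (phi (first c)).
have rhoE e : rho (path_class s e) = path_class s' (phi e).
  by apply/phi_class; rewrite firstE.
have rho_bij : bijective rho.
  apply: bijective_of_inj_surj => [c d /phi_class|c']; first by rewrite !firstE.
  exists (path_class s (psi (path_edge s' c' 0))).
  by rewrite rhoE psiK; apply/path_edge_class/path_length_gt0.
have rho_inj := bij_inj rho_bij.
have class_rho (S : {set edge Y}) : path_class s' @^-1: (rho @: S) = phi @: (path_class s @^-1: S).
  apply/setP => e; rewrite -[e]psiK (mem_imset _ _ phi_inj) !inE -rhoE.
  by rewrite (mem_imset _ _ rho_inj).
have rho_prod (S : {set edge Y}) : degree_prod (rho @: S) = degree_prod S.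
  have : signed_degree_prod (rho @: S) = signed_degree_prod S.
    rewrite -weight -weight' class_rho /signed_degree_prod phi_prod.
    by rewrite card_imset.
  by rewrite /signed_degree_prod card_imset // => /(mulfI (negbT (signr_eq0 _ _))).
have rho_length c : path_length s' (rho c) = path_length s c.
  rewrite !path_lengthE -(card_imset _ phi_inj); apply: eq_card => e.
  by rewrite -[e]psiK (mem_imset _ _ phi_inj) !inE -rhoE (inj_eq rho_inj).
have [f f_bij f_inc] := reduced_vertex_bijection rho_bij mdY mdY' redY redY' rho_prod.
apply: (subdivision_iso (s := s) (s' := s') f_bij rho_bij _ rho_length) => c.
exact: (ends_of_incident f_bij (f_inc c)).
Qed.

Local Open Scope ring_scope.

(** * The zeta function determines the graph *)

Lemma degree_prod_of_zeta (K : realType) (X X' : multigraph) (phi : arc X -> arc X') :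
  bijective phi -> (forall a, phi (inv_arc a) = inv_arc (phi a)) -> zeta_match K phi ->
  exists2 psi : edge X -> edge X', bijective psi &
    forall S : {set edge X}, degree_prod (psi @: S) = degree_prod S.
Proof.
move=> [phi' phiK phiK'] phi_inv [r r0 match_r].
pose psi e := (phi (e, false)).1.
have psiE a : (phi a).1 = psi a.1.
  by case: a => e [] //; rewrite -[(e, true)]/(inv_arc ((e, false) : arc X)) phi_inv.
have psi_inj : injective psi.
  move=> e g; rewrite /psi => eg.
  have [/(can_inj phiK)[]//|ne] := eqVneq (phi (e, false)) (phi (g, false)).
  suff /(can_inj phiK)[] : phi (inv_arc ((e, false) : arc X)) = phi (g, false) by [].
  rewrite phi_inv /inv_arc eg [RHS]surjective_pairing; congr (_, _).
  move: ne; rewrite [phi (e, _)]surjective_pairing [phi (g, _)]surjective_pairing eg.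
  by rewrite xpair_eqE eqxx /=; do 2!case: (_.2).
have psi_bij : bijective psi.
  apply: bijective_of_inj_surj => // e'; exists (phi' (e', false)).1.
  by rewrite -psiE phiK'.
exists psi => // S.
apply: degree_prod_of_closed_walks => [|n n0]; first by rewrite card_imset.
rewrite !card_closed_walks //; apply: eq_bigr => d _; congr (_ * _)%N.
apply: (@prime_count_of_zeta K _ _ _ _ r) => // t /andP[t0 tr].
rewrite -match_r => [|a].
  congr edge_zeta; apply: funext => a; rewrite /indicator_weight /= !inE psiE.
  by rewrite mem_imset.
rewrite /indicator_weight; case: ifP => _; last by rewrite normr0 ltcR.
by rewrite normc_def /= expr0n addr0 sqrtr_sqr ltcR gtr0_norm.
Qed.

(** * Invariance of the subgraph counts *)

Lemma graph_iso_sym (X Y : multigraph) : graph_iso X Y -> graph_iso Y X.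
Proof.
move=> [f [h [[g fK gK] [k hK kK] fh]]]; exists g, k; split=> [||e]; [by exists f|by exists h|].
have := fh (k e); rewrite kK /swap /= => -[->|->] /=; rewrite !fK -surjective_pairing; auto.
Qed.

Lemma graph_iso_trans (X Y Z : multigraph) : graph_iso X Y -> graph_iso Y Z -> graph_iso X Z.
Proof.
move=> [f [h [fb hb fh]]] [g [k [gb kb gk]]].
exists (g \o f), (k \o h); split; [exact: bij_comp|exact: bij_comp|move=> e /=].
have := gk (h e); have := fh e; rewrite /swap /= => -[->|->] /= [->|->]; auto.
Qed.

Lemma card_asbool_imset (T T' : finType) (g : T -> T')
    (P : {set T} -> Prop) (Q : {set T'} -> Prop) :
  injective g -> (forall A, P A -> Q (g @: A)) ->
  (#|(fun A : {set T} => `[<P A>])| <= #|(fun A : {set T'} => `[<Q A>])|)%N.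
Proof.
move=> g_inj PQ; rewrite -(card_imset _ (imset_inj g_inj)); apply/subset_leq_card/subsetP.
by move=> _ /imsetP[A /asboolP PA ->]; apply/asboolP/PQ.
Qed.

Section Invariance.
Variables (X X' : multigraph) (f : vertex X -> vertex X') (h : edge X -> edge X').
Hypotheses (f_bij : bijective f) (h_bij : bijective h).
Hypothesis fh : forall e, let p := (f (ends e).1, f (ends e).2) in
  ends (h e) = p \/ ends (h e) = swap p.

Let f_inj := bij_inj f_bij.
Let h_inj := bij_inj h_bij.

Lemma vertex_induced_iso (S : {set vertex X}) :
  graph_iso (vertex_induced S) (vertex_induced (f @: S)).
Proof.
have edgeP e : ((ends (h e)).1 \in f @: S) && ((ends (h e)).2 \in f @: S) =
    ((ends e).1 \in S) && ((ends e).2 \in S).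
  by case: (fh e) => -> /=; rewrite !(mem_imset _ _ f_inj) // andbC.
pose F (v : vertex (vertex_induced S)) : vertex (vertex_induced (f @: S)) :=
  exist _ (f (val v)) (imset_f f (valP v)).
pose H (e : edge (vertex_induced S)) : edge (vertex_induced (f @: S)) :=
  exist _ (h (val e)) (etrans (edgeP (val e)) (valP e)).
exists F, H; split.
- apply: bijective_of_inj_surj => [u v /(congr1 val)/f_inj/val_inj //|[w wS]].
  have /imsetP[v vS wv] := wS.
  by exists (exist _ v vS); apply: val_inj; rewrite /= wv.
- apply: bijective_of_inj_surj => [u v /(congr1 val)/h_inj/val_inj //|[w wS]].
  have [k _ kK] := h_bij.
  have kS : ((ends (k w)).1 \in S) && ((ends (k w)).2 \in S) by rewrite -edgeP kK.
  by exists (exist _ (k w) kS); apply: val_inj; rewrite /= kK.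
move=> e; have := fh (val e); rewrite /swap /=.
by case=> eh; [left|right]; congr (_, _); apply: val_inj; rewrite /= eh.
Qed.

Lemma edge_induced_iso (S : {set edge X}) :
  graph_iso (edge_induced S) (edge_induced (h @: S)).
Proof.
have vertexP v : incident (h @: S) (f v) = incident S v.
  have incE e : ((f v == (ends (h e)).1) || (f v == (ends (h e)).2)) =
      ((v == (ends e).1) || (v == (ends e).2)).
    by case: (fh e) => -> /=; rewrite !(inj_eq f_inj) // orbC.
  apply/exists_inP/exists_inP => [[_ /imsetP[e eS ->]]|[e eS]].
    by rewrite incE; exists e.
  by rewrite -incE; exists (h e); rewrite ?imset_f.
pose F (v : vertex (edge_induced S)) : vertex (edge_induced (h @: S)) :=
  exist _ (f (val v)) (etrans (vertexP (val v)) (valP v)).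
pose H (e : edge (edge_induced S)) : edge (edge_induced (h @: S)) :=
  exist _ (h (val e)) (imset_f h (valP e)).
exists F, H; split.
- apply: bijective_of_inj_surj => [u v /(congr1 val)/f_inj/val_inj //|[w wS]].
  have [k _ kK] := f_bij.
  have kS : incident S (k w) by rewrite -vertexP kK.
  by exists (exist _ (k w) kS); apply: val_inj; rewrite /= kK.
- apply: bijective_of_inj_surj => [u v /(congr1 val)/h_inj/val_inj //|[w wS]].
  have /imsetP[v vS wv] := wS.
  by exists (exist _ v vS); apply: val_inj; rewrite /= wv.
move=> e; have := fh (val e); rewrite /swap /=.
by case=> eh; [left|right]; congr (_, _); apply: val_inj; rewrite /= eh.
Qed.

End Invariance.

Lemma s_vE W X : s_v W X = #|(fun S : {set vertex X} => `[<graph_iso (vertex_induced S) W>])|.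
Proof.
by apply: eq_card => S; apply/idP/idP => [/classical_sets.set_mem|H]; [|exact: classical_sets.mem_set].
Qed.

Lemma s_eE W X : s_e W X = #|(fun S : {set edge X} => `[<graph_iso (edge_induced S) W>])|.
Proof.
by apply: eq_card => S; apply/idP/idP => [/classical_sets.set_mem|H]; [|exact: classical_sets.mem_set].
Qed.

Lemma s_v_le W X X' : graph_iso X X' -> (s_v W X <= s_v W X')%N.
Proof.
move=> [f [h [fb hb fh]]]; rewrite !s_vE; apply: (card_asbool_imset (bij_inj fb)) => S.
exact: graph_iso_trans (graph_iso_sym (vertex_induced_iso fb hb fh S)).
Qed.

Lemma s_e_le W X X' : graph_iso X X' -> (s_e W X <= s_e W X')%N.
Proof.
move=> [f [h [fb hb fh]]]; rewrite !s_eE; apply: (card_asbool_imset (bij_inj hb)) => S.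
exact: graph_iso_trans (graph_iso_sym (edge_induced_iso fb hb fh S)).
Qed.

Theorem iso_of_zeta (K : realType) (X X' : multigraph) (phi : arc X -> arc X') :
  md2 X -> md2 X' -> bijective phi -> (forall a, phi (inv_arc a) = inv_arc (phi a)) ->
  zeta_match K phi -> graph_iso X X'.
Proof.
move=> md md' phi_bij phi_inv /(degree_prod_of_zeta phi_bij phi_inv)[psi psi_bij psi_prod].
exact: iso_of_degree_prod psi_prod.
Qed.

Theorem theorem4 (R : realType) (k : nat) (W : multigraph)
    (W_graph : is_graph W) (W_regular : regular k W)
    (W_spectrum : determined_by_spectrum R W) :
  determined_by_zeta R (fun X => is_graph X /\ md2 X) (s_v W) /\
  determined_by_zeta R (fun X => is_graph X /\ md2 X) (s_e W).
Proof.
split=> X X' [_ md] [_ md'] phi phi_bij phi_inv phi_match;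
  have iso := iso_of_zeta md md' phi_bij phi_inv phi_match.
  by apply/eqP; rewrite eqn_leq !s_v_le //; apply: graph_iso_sym.
by apply/eqP; rewrite eqn_leq !s_e_le //; apply: graph_iso_sym.
Qed.
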